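(* Let $q$ be an odd prime power, $g\ge1$, and $D\in\mathbb{F}_q[x]$ monic square-free of degree $2g+1$. Define for $u\in\mathbb{C}$ $$\mathcal{F}(u,\chi_D)=\tfrac12\big(\mathcal{L}(u,\chi_D)+(qu^2)^g\mathcal{L}(\overline{u},\chi_D)\big).$$ Then $\mathcal{F}(u,\chi_D)$ and $\mathcal{L}(u,\chi_D)$ have the same zeros in $\mathbb{C}$. In particular, all zeros of $\mathcal{F}(u,\chi_D)$ lie on the circle $|u|=q^{-1/2}$.
   Context: $\chi_D(f)=(D/f)$ is the quadratic character given by the Jacobi symbol on $\mathbb{F}_q[x]$; $\mathcal{L}(u,\chi_D)=\sum_{f\ \mathrm{monic}}\chi_D(f)u^{\deg f}$, which is a polynomial of degree $2g$ with real coefficients, all of whose zeros lie on $|u|=q^{-1/2}$, satisfying $\mathcal{L}(u,\chi_D)=(qu^2)^g\mathcal{L}(1/(qu),\chi_D)$. *)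

(* Defs.v *)
(* MathComp / MathComp-Analysis; the complex numbers are R[i], R : realType. *)
From HB Require Import structures.
From mathcomp Require Import all_boot all_order all_algebra all_field.
From mathcomp Require Import boolp classical_sets reals topology normedtype.
From mathcomp Require Import sequences complex.

Set Implicit Arguments.
Unset Strict Implicit.
Unset Printing Implicit Defensive.

Import Order.TTheory GRing.Theory Num.Theory numFieldNormedType.Exports.
Local Open Scope ring_scope.
Local Open Scope complex_scope.

Definition squarefree_poly (F : fieldType) (A : {poly F}) : Prop :=
  forall P : {poly F}, size P != 1%N -> ~~ (P ^+ 2 %| A).

Section JacobiSymbol.
Variable F : finFieldType.
Implicit Types A P f : {poly F}.

(* Quadratic residue symbol (A/P), for P irreducible. *)
Definition legendre A P : int :=
  if P %| A then 0
  else if `[< exists h : {poly F}, P %| h ^+ 2 - A >] then 1 else -1.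

(* For f != 0 and P nonconstant, P ^+ k %| f forces k < size f, so this is the
   largest k such that P ^+ k divides f. *)
Definition multiplicity P f : nat := \max_(k < size f | P ^+ k %| f) k.

(* Jacobi symbol (A/f) for f monic: if f = prod_i P_i ^ e_i with P_i monic
   irreducible, (A/f) = prod_i (A/P_i) ^ e_i.  The product may range over all
   monic irreducible P with deg P <= deg f, since those that do not divide f
   have exponent 0. *)
Definition jacobi A f : int :=
  \prod_(P : {poly_(size f) F}
         | (polyn P \is monic) && irreducibleb (polyn P))
     legendre A P ^+ multiplicity P f.

Definition chi (D f : {poly F}) : int := jacobi D f.

Definition Lcoef (D : {poly F}) (n : nat) : int :=
  \sum_(f : {poly_n.+1 F} | (polyn f \is monic) && (size (polyn f) == n.+1))
     chi D f.

End JacobiSymbol.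

(* The sum over monic f of chi_D(f) u^(deg f), terms of equal degree being
   grouped: this is the meaning of the sum as a power series in u, and the
   grouping is needed for it to make sense on the whole complex plane.  The
   regular module (R[i])^o is R[i] with the topology of its norm. *)
Definition Lfun (R : realType) (F : finFieldType) (D : {poly F}) (u : R[i]) :
    R[i] :=
  limn (series (fun n : nat => (Lcoef D n)%:~R * u ^+ n : (R[i])^o)).

Definition Ffun (R : realType) (F : finFieldType) (g : nat) (D : {poly F})
    (u : R[i]) : R[i] :=
  2^-1 * (Lfun D u + (#|F|%:R * u ^+ 2) ^+ g * Lfun D u^*).

(* Main.v *)
(* Counting roots of P for each monic irreducible P turns the Euler product of
   L(u, chi_D) into Newton's identities relating the coefficients of L to the
   character sums S_k of chi(D(x)) over the x with x^(q^k) = x in an algebraic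
   closure K of F_q.  Hence S_k = - sum_i alpha_i^k, where the 1/alpha_i are the
   zeros of L, and |alpha_i|^2 <= q follows from S_(2m) = O(q^m).
   This bound is Stepanov's, in Bombieri's form: over the field with s^2
   elements, s = q^m, linear algebra yields a nonzero polynomial h of degree
   about s^2/2 whose s-th power agrees, at the x with chi(D(x)) = 1, with a
   polynomial that vanishes identically; so h itself vanishes there, and the
   number of such x is at most deg h.  No derivatives are needed.
   The functional equation comes from reciprocity and Gauss sums modulo D.  The
   sign is determined by comparing the Gauss sum of the Jacobi symbol mod D with
   that of the quadratic form a |-> res(a^2/D), which is a sum of g hyperbolic
   planes and a line because deg D is odd.  With it, |alpha_i|^2 = q.
   Finally, |L(conj u)| = |L(u)|, so F(u) = 0 forces L(u) = 0 or |q u^2| = 1, and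
   on that circle the functional equation reads F = L. *)
Require Import Defs.
From HB Require Import structures.
From mathcomp Require Import all_boot all_order all_algebra all_fingroup.
From mathcomp Require Import all_solvable all_field all_character.
From mathcomp Require Import boolp classical_sets reals topology normedtype.
From mathcomp Require Import sequences complex.
From mathcomp Require Import zify ring.

Set Implicit Arguments.
Unset Strict Implicit.
Unset Printing Implicit Defensive.

Import Order.TTheory GRing.Theory Num.Theory numFieldNormedType.Exports.
Local Open Scope ring_scope.

(** * Stepanov's method for y^2 = D(x) *)

(** All symbols are computed in an algebraic closure [K]: for monic f, (A/f) is the ((q-1)/2)-th
    power of the resultant of f and A. Multiplicativity, periodicity and reciprocity thus become
    identities of products over roots, and the values 0, 1, -1 can be read back as integers because
    2 is nonzero in [K]. Stepanov's method only gives upper bounds for counts. Applied with both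
    signs e = 1 and e = -1, it bounds S_k from both sides, since the two counts and the number of
    zeros of D add up to the size of the field. The exponent s acts well only on a field with s^2
    elements, so only even k are reached; this suffices, because S_(2m) is a power sum of the
    alpha_i^2. In the functional equation the quadratic Gauss sum G of F_q occurs twice: as the
    factor contributed by the line in the quadratic form modulo D, and in the sum over the leading
    coefficients of the a that survive on the dual side. It cancels as soon as it is nonzero, and
    the exact sign remains. *)

Lemma exprDn_pchar_sum (K : comNzRingType) (n : nat) (I : Type) (r : seq I) (P : pred I) (G : I -> K) :
  [pchar K].-nat n ->
  (\sum_(i <- r | P i) G i) ^+ n = \sum_(i <- r | P i) G i ^+ n.
Proof.
move=> n_char; elim/big_rec2: _ => [|i y x _ <-]; last exact: exprDn_pchar.
by case/andP: n_char => n_gt0 _; rewrite expr0n gtn_eqF.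
Qed.

Lemma linear_dependence (K : fieldType) (I : finType) (E : nat) (p : I -> {poly K}) :
  (forall i, (size (p i) <= E)%N) -> (E < #|I|)%N ->
  exists2 c : I -> K, exists i, c i != 0 & \sum_i c i *: p i = 0.
Proof.
move=> size_p ltEI.
pose A : 'M[K]_(#|I|, E) := \matrix_(r, k) (p (enum_val r))`_k.
have kerA : kermx A != 0.
  rewrite -mxrank_eq0 mxrank_ker -lt0n subn_gt0.
  by rewrite (leq_ltn_trans (rank_leq_col _)).
have /rowV0Pn[v v_ker v_neq0] := kerA.
exists (fun i => v 0 (enum_rank i)).
  have /rV0Pn[r vr] := v_neq0.
  by exists (enum_val r); rewrite enum_valK.
apply/polyP => k; rewrite coef_sum coef0.
have [ltkE|leEk] := ltnP k E; last first.
  by rewrite big1 // => i _; rewrite coefZ (nth_default 0) ?mulr0 // (leq_trans (size_p i)).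
have /sub_kermxP/rowP/(_ (Ordinal ltkE)) := v_ker.
rewrite !mxE => vA; rewrite -[RHS]vA (reindex (fun r : 'I_#|I| => enum_val r)) /=; last exact/onW_bij/enum_val_bij.
by apply: eq_bigr => r _; rewrite coefZ !mxE enum_valK.
Qed.

(** Among the terms with nonzero coefficient, the one of largest size has a leading coefficient that
    nothing cancels. *)
Lemma size_inj_free (K : fieldType) (I : finType) (p : I -> {poly K}) (y : I -> K) :
  (forall i, p i != 0) -> injective (fun i => size (p i)) ->
  \sum_i y i *: p i = 0 -> forall i, y i = 0.
Proof.
move=> p_neq0 size_inj sum0 i0; apply/eqP/negPn/negP => yi0.
have [i yi max_i] := @arg_maxnP _ i0 (fun i => y i != 0) (fun i => size (p i)) yi0.
move/polyP/(_ (size (p i)).-1): sum0.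
rewrite coef_sum coef0 (bigD1 i) //= big1 => [|j neq_ji].
  rewrite addr0 coefZ -lead_coefE => /eqP; rewrite mulf_eq0 lead_coef_eq0.
  by rewrite (negPf yi) (negPf (p_neq0 i)).
rewrite coefZ; have [-> | yj] := eqVneq (y j) 0; first by rewrite mul0r.
rewrite nth_default ?mulr0 //.
have := max_i j yj; rewrite /= leq_eqVlt => /orP[/eqP/size_inj eq_ji|].
  by rewrite eq_ji eqxx in neq_ji.
by rewrite -{1}(prednK (_ : 0 < size (p i))%N) // lt0n size_poly_eq0.
Qed.

Lemma closed_root (K : closedFieldType) (n : nat) (x : K) : (0 < n)%N -> exists y, y ^+ n = x.
Proof.
move=> n_gt0; have [y] := @solve_monicpoly K n (fun i => x *+ (i == 0)) n_gt0.
rewrite -(prednK n_gt0) big_ord_recl big1 => [|i _]; last by rewrite mul0r.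
by rewrite expr0 mulr1 addr0 => ?; exists y.
Qed.

Section Stepanov.

Variables (K : closedFieldType) (g t : nat).
Let s := t.*2.+1.
Hypothesis s_char : [pchar K].-nat s.
Hypothesis lt_gt : (g < t)%N.

Let expf_eq0_s (x : K) : (x ^+ s == 0) = (x == 0).
Proof. by rewrite expf_eq0. Qed.

(** With these ranges there are (t+g+1)(2t+1-g) indices against 2t^2+2t+g+1 possible coefficients of
    [src]. The excess is (t-g)(g+1), positive because g < t. *)
Let n := (t + g).+1.
Let I : finType := ('I_t.+1 * 'I_n + 'I_(t - g) * 'I_n)%type.

Variables (D : {poly K}) (e : K).
Hypothesis size_D : size D = g.*2.+2.

Let D1 := D ^+ t.+1.

Let D_neq0 : D != 0.
Proof. by rewrite -size_poly_eq0 size_D. Qed.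

Let D1_neq0 : D1 != 0.
Proof. by rewrite expf_neq0. Qed.

Let size_D1 : size D1 = (g.*2.+1 * t.+1).+1.
Proof.
by rewrite (polySpred D1_neq0) size_exp size_D.
Qed.

(* A dependency sum_i y_i^s src_i = 0 gives h = sum_i y_i tgt_i, whose s-th power
   takes the same values as sum_i y_i^s src_i at the points x with x^(s^2) = x
   and D(x)^((t+1) s) = e D(x)^(t+1).  There are more indices than the degree bound
   for src, and the degrees of the tgt_i are pairwise distinct, so that h is
   nonzero. *)
Let src (i : I) : {poly K} := match i with
  | inl ij => 'X^(ij.1 * s + ij.2)
  | inr ij => e *: (D1 * 'X^(ij.1 * s + ij.2)) end.

Let tgt (i : I) : {poly K} := match i with
  | inl ij => 'X^(ij.1 + ij.2 * s)
  | inr ij => D1 * 'X^(ij.1 + ij.2 * s) end.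

Let size_D1X m : size (D1 * 'X^m) = (g.*2.+1 * t.+1 + m).+1.
Proof.
by rewrite size_Mmonic ?monicXn // size_D1 size_polyXn addnS.
Qed.

Let size_src i : (size (src i) <= t.*2 * t + t.*2 + g.+1)%N.
Proof.
case: i => [[[i lti] [j ltj]]|[[i lti] [j ltj]]] /=.
  by rewrite size_polyXn /s; rewrite /n in ltj; nia.
rewrite (leq_trans (size_scale_leq _ _)) // size_D1X /s; rewrite /n in ltj; move: ltj.
have : (i.+1 * t.*2.+1 <= (t - g) * t.*2.+1)%N by rewrite leq_mul2r lti orbT.
have [u ->] : exists u, t = (g + u)%N by exists (t - g)%N; lia.
by rewrite addKn; nia.
Qed.

(** Base-[s] digits of the degree of [tgt i]. Since deg D1 = (2g+1)(t+1) = (g+t+1) + g s,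
    multiplication by [D1] moves the low digit from the range 0..t into g+t+1..2t without carry, so
    the two families of indices never collide. *)
Let rank_src i := match i : I with
  | inl ij => (ij.1 + ij.2 * s)%N
  | inr ij => ((g + t.+1 + ij.1) + (g + ij.2) * s)%N end.

Let size_tgt i : size (tgt i) = (rank_src i).+1.
Proof.
case: i => [[[i lti] [j ltj]]|[[i lti] [j ltj]]] /=; first by rewrite size_polyXn.
by rewrite size_D1X /s; congr _.+1; lia.
Qed.

Let rank_inj : injective (fun i => size (tgt i)).
Proof.
move=> i1 i2 /=; rewrite !size_tgt => -[].
have divs a b : (a < s)%N -> ((a + b * s) %/ s)%N = b.
  by move=> ltas; rewrite addnC divnMDl // divn_small ?addn0.
have mods a b : (a < s)%N -> ((a + b * s) %% s)%N = a.
  by move=> ltas; rewrite addnC modnMDl modn_small.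
have eqs a b a' b' : (a < s)%N -> (a' < s)%N -> (a + b * s = a' + b' * s)%N -> a = a' /\ b = b'.
  move=> lta lta' eqab; split.
    by rewrite -(mods a b lta) -(mods a' b' lta') eqab.
  by rewrite -(divs a b lta) -(divs a' b' lta') eqab.
case: i1 i2 => [[[i lti] [j ltj]]|[[i lti] [j ltj]]] [[[i' lti'] [j' ltj']]|[[i' lti'] [j' ltj']]] /=;
  move=> /eqs[]; rewrite /s; try lia.
- by move=> ? ?; subst; congr (inl (_, _)); apply: val_inj.
- by move=> ? ?; have [? ?] : i = i' /\ j = j' by [lia]; subst; congr (inr (_, _)); apply: val_inj.
Qed.

Lemma stepanov (rs : seq K) :
  uniq rs ->
  {in rs, forall x, x ^+ (s ^ 2) = x /\ D.[x] ^+ (t.+1 * s) = e * D.[x] ^+ t.+1} ->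
  (size rs < (g.*2 + t.+1) * s)%N.
Proof.
move=> uniq_rs rsP.
have [|c [i0 ci0] sum_c] := linear_dependence size_src.
  rewrite card_sum !card_prod !card_ord /n.
  have [u ->] : exists u, t = (g + u.+1)%N by exists (t - g).-1; lia.
  by rewrite addKn; nia.
have [y yP] : exists y : I -> K, forall i, y i ^+ s = c i.
  have root i : exists z, z ^+ s == c i.
    by have [z <-] := closed_root (c i) (ltn0Sn t.*2); exists z.
  by exists (fun i => xchoose (root i)) => i; apply/eqP; exact: xchooseP (root i).
pose h := \sum_i y i *: tgt i.
have h_neq0 : h != 0.
  apply/eqP => /size_inj_free h0; have/eqP := yP i0.
  rewrite h0 ?expr0n /=; first by rewrite eq_sym (negPf ci0).
    by move=> i; rewrite -size_poly_eq0 size_tgt.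
  exact: rank_inj.
(* The high base-[s] digit of every degree is at most 2g+t. *)
have size_h : (size h <= (g.*2 + t.+1) * s)%N.
  apply: (leq_trans (size_sum _ _ _)); apply/bigmax_leqP => i _.
  apply: (leq_trans (size_scale_leq _ _)); rewrite size_tgt.
  by case: i => [[[i lti] [j ltj]]|[[i lti] [j ltj]]] /=; rewrite /n in ltj; rewrite /s; nia.
apply: leq_trans size_h; apply: max_poly_roots => //.
apply/allP => x /rsP[xQ Dx]; rewrite rootE -(expf_eq0_s h.[x]).
have src0 : \sum_i (c i *: src i).[x] = 0 by rewrite -horner_sum sum_c horner0.
rewrite /h horner_sum exprDn_pchar_sum //; apply/eqP; rewrite -[RHS]src0.
apply: eq_bigr => i _; rewrite !hornerZ exprMn yP; congr (_ * _).
(* The s-th power turns the exponent a + b s into a s + b s^2, which x^(s^2) = x reduces to a s + b: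
   the two base-[s] digits are swapped. *)
have powx a b : x ^+ (a + b * s) ^+ s = x ^+ (a * s + b).
  by rewrite -exprM mulnDl -mulnA mulnn !exprD (mulnC b) (exprM x (s ^ 2)) xQ.
case: i => [[a b]|[a b]] /=; rewrite ?hornerZ ?hornerM ?hornerXn ?exprMn powx //.
by rewrite horner_exp -exprM Dx mulrA.
Qed.

End Stepanov.

(* Lifts 0, 1, -1 : K to the integers 0, 1, -1, provided 2 != 0 in K. *)
Definition lift_sign (K : nzRingType) (z : K) : int := (z == 1)%:Z - (z == -1)%:Z.

(** Let N+, N-, N0 count the x with D(x)^r = 1, D(x)^r = -1, D(x) = 0. Both N+ + N0 and N- + N0 are
    below (2g+t+1) s, and the three numbers add up to s^2. Hence |N+ - N-| is at most 2(2g+t+1) s -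
    s^2 = (4g+1) s. *)
Lemma stepanov_bound (K : closedFieldType) (g t : nat) (D : {poly K}) (rs : seq K) :
  let s := t.*2.+1 in
  [pchar K].-nat s -> (2%:R != 0 :> K) -> (g < t)%N -> size D = g.*2.+2 ->
  uniq rs -> size rs = (s ^ 2)%N -> {in rs, forall x, x ^+ (s ^ 2) = x} ->
  {in rs, forall x, D.[x] ^+ (s ^ 2) = D.[x]} ->
  `|\sum_(x <- rs) lift_sign (D.[x] ^+ (s ^ 2).-1./2)| <= (g.*2.*2.+1 * s)%N%:Z.
Proof.
move=> s s_char two_neq0 lt_gt size_D uniq_rs size_rs rsQ DQ.
set r := (s ^ 2).-1./2.
have r_eq : r = (t.*2 * t.+1)%N by rewrite /r /s; nia.
(* This makes D(x)^r = e imply the hypothesis of [stepanov]; where D(x) = 0, both sides of that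
   hypothesis vanish. *)
have r_eqs : (t.+1 * s = r + t.+1)%N by rewrite r_eq /s; nia.
have count_bound e : (count (fun x => ((D.[x] ^+ r == e) || (D.[x] == 0))%R) rs < (g.*2 + t.+1) * s)%N.
  rewrite -size_filter; apply: (stepanov s_char lt_gt (e := e) size_D); first exact: filter_uniq.
  move=> x; rewrite mem_filter => /andP[Dx x_rs]; split; first exact: rsQ.
  rewrite -/s r_eqs exprD; case/orP: Dx => [/eqP-> // | /eqP->].
  by rewrite (expr0n _ t.+1) !mulr0.
have sgn1 : (-1 == 1 :> K) = false.
  by apply/negbTE; rewrite eq_sym -subr_eq0 opprK.
have count_or e : e != 0 -> count (fun x => ((D.[x] ^+ r == e) || (D.[x] == 0))%R) rs =
    (count (fun x => (D.[x] ^+ r == e)%R) rs + count (fun x => (D.[x] == 0)%R) rs)%N.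
  move=> e_neq0; rewrite -count_predUI; set c := count (predI _ _) _.
  suff -> : c = 0%N by rewrite addn0.
  apply/eqP; rewrite -leqn0 leqNgt -has_count; apply/hasP => -[x _ /= /andP[De /eqP D0]].
  move: De; rewrite D0 expr0n r_eq; have -> : (t.*2 * t.+1 == 0)%N = false by lia.
  by rewrite /= eq_sym (negPf e_neq0).
have Np := count_bound 1; have Nm := count_bound (-1).
rewrite !count_or ?oppr_eq0 ?oner_eq0 // in Np Nm.
have total : (count (fun x => (D.[x] ^+ r == 1)%R) rs + count (fun x => (D.[x] ^+ r == -1)%R) rs
   + count (fun x => (D.[x] == 0)%R) rs = s ^ 2)%N.
  rewrite -size_rs; elim: (rs) (DQ) => //= x l IHl DQl.
  have -> : size l = (count (fun x => (D.[x] ^+ r == 1)%R) l + count (fun x => (D.[x] ^+ r == -1)%R) l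
   + count (fun x => (D.[x] == 0)%R) l)%N by rewrite IHl // => y yl; apply: DQl; rewrite inE yl orbT.
  suff : ((D.[x] ^+ r == 1)%R + (D.[x] ^+ r == -1)%R + (D.[x] == 0)%R = 1)%N.
    by do 3 move: (count _ l) => ?; do 3 move: (nat_of_bool _) => ?; lia.
  have [-> | Dx] := eqVneq D.[x] 0.
    rewrite expr0n r_eq; have -> : (t.*2 * t.+1 == 0)%N = false by lia.
    by rewrite eq_sym oner_eq0 eq_sym oppr_eq0 oner_eq0.
  have : (D.[x] ^+ r) ^+ 2 = 1.
    apply: (mulIf Dx); rewrite -exprM -exprSr mul1r.
    have -> : (r * 2).+1 = (s ^ 2)%N by rewrite r_eq /s; nia.
    by apply: DQl; rewrite mem_head.
  by move/eqP; rewrite sqrf_eq1 => /orP[] /eqP->; rewrite ?eqxx ?sgn1 // eq_sym sgn1.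
have -> : \sum_(x <- rs) lift_sign (D.[x] ^+ r) =
   (count (fun x => (D.[x] ^+ r == 1)%R) rs)%:Z - (count (fun x => (D.[x] ^+ r == -1)%R) rs)%:Z.
  elim: (rs) => [|x l IHl]; first by rewrite big_nil.
  by rewrite big_cons IHl /= /lift_sign !PoszD opprD addrACA.
move: Np Nm total; set a := count _ _; set b := count _ _; set c := count _ _ => Np Nm total.
have e1 : ((g.*2 + t.+1) * s = 2 * (g * s) + t * s + s)%N by rewrite -mul2n; ring.
have e2 : (s ^ 2 = 2 * (t * s) + s)%N by rewrite expnS expn1 {1}/s -mul2n; ring.
have e3 : (g.*2.*2.+1 * s = 4 * (g * s) + s)%N by rewrite -!mul2n; ring.
have -> : (g.*2.*2.+1 * s)%N%:Z = (4 * (g * s) + s)%N%:Z by rewrite -e3.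
move: Np Nm total; rewrite e1 e2.
by move: (g * s)%N (t * s)%N => X Y; clear; lia.
Qed.

(** * Irreducible polynomials and their roots in an algebraic closure *)

Section Irreducible.

Variables (F : finFieldType) (K : closedFieldType) (iota : {rmorphism F -> K}).
Local Notation q := #|F|.
Local Notation "p ^:K" := (map_poly iota p) (at level 2, format "p ^:K").
Implicit Types (A P f h : {poly F}) (x y z th : K).

Lemma card_pchar_nat (k : nat) : [pchar K].-nat (q ^ k)%N.
Proof.
have [p p_pr pF] := finPcharP F.
have pg := abelem_pgroup (fin_ring_pchar_abelem pF).
have : p.-nat (q ^ k)%N by rewrite pnatX; rewrite /pgroup cardsT in pg; rewrite pg.
by apply: sub_in_pnat => r _ /eqP->; rewrite (fmorph_pchar iota).
Qed.

Lemma iota_frob (k : nat) (c : F) : iota c ^+ (q ^ k) = iota c.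
Proof.
rewrite -rmorphXn /=; congr (iota _).
by elim: k => [|k IHk]; rewrite ?expr1 // expnS exprM expf_card.
Qed.

Lemma horner_frob (k : nat) A x : A^:K.[x] ^+ (q ^ k) = A^:K.[x ^+ (q ^ k)].
Proof.
rewrite !horner_coef.
rewrite exprDn_pchar_sum ?card_pchar_nat //; apply: eq_bigr => i _.
by rewrite exprMn coef_map iota_frob exprAC.
Qed.

Lemma irr_root_eq0 P A th :
  irreducible_poly P -> root P^:K th -> (A^:K.[th] == 0) = (P %| A).
Proof.
move=> P_irr P_th; apply/idP/idP => [A_th | /dvdpP[B ->]]; last first.
  by rewrite rmorphM hornerM (rootP P_th) mulr0.
rewrite -[_ %| _]negbK -irreducible_poly_coprime //; apply/negP.
rewrite -(coprimep_map iota) => /coprimep_root/(_ P_th).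
by rewrite A_th.
Qed.

(** Fermat's identity in the field F[X]/(P) with q^(deg P) elements, carried to [K] by evaluation at
    th. *)
Lemma irr_frob P A th : monic_irreducible_poly P -> root P^:K th ->
  A^:K.[th] ^+ (q ^ (size P).-1) = A^:K.[th].
Proof.
move=> P_mi P_th; set N := (q ^ _)%N.
suff dvd_P : P %| A ^+ N - A.
  apply/eqP; rewrite -subr_eq0 -horner_exp -hornerN -hornerD -rmorphXn -rmorphB /=.
  by rewrite (irr_root_eq0 _ (P_mi.1) P_th).
have eqA : in_qpoly P (A ^+ N) = in_qpoly P A.
  rewrite rmorphXn /= /N -(card_qfpoly P_mi).
  exact: (expf_card (in_qpoly P A : {poly %/ P with P_mi})).
move/(congr1 val): eqA; rewrite /= mk_monicE // => eqA.
rewrite -!Pdiv.IdomainMonic.modpE ?P_mi.2 // in eqA.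
by apply/modp_eq0P; rewrite modpD modpN eqA subrr.
Qed.

Lemma size_XqX (R : nzRingType) (n : nat) : (1 < n)%N -> size ('X^n - 'X : {poly R}) = n.+1.
Proof. by move=> n_gt1; rewrite size_polyDl size_polyXn // size_polyN size_polyX. Qed.

Lemma leq_fixed_roots (n : nat) (rs : seq K) : (1 < n)%N -> uniq rs ->
  {in rs, forall x, x ^+ n = x} -> (size rs <= n)%N.
Proof.
move=> n_gt1 uniq_rs rsP; rewrite -ltnS -(size_XqX K n_gt1).
apply: max_poly_roots => //; first by rewrite -size_poly_eq0 size_XqX.
by apply/allP => x /rsP xn; rewrite rootE !hornerE xn subrr.
Qed.

Definition horner_npoly (d : nat) th : seq K := [seq (polyn h)^:K.[th] | h : {poly_d F}].

Lemma size_horner_npoly d th : size (horner_npoly d th) = (q ^ d)%N.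
Proof. by rewrite size_map -cardE card_npoly. Qed.

Lemma uniq_horner_npoly P th : irreducible_poly P -> root P^:K th ->
  uniq (horner_npoly (size P).-1 th).
Proof.
move=> P_irr P_th; rewrite map_inj_uniq ?enum_uniq // => a b /eqP.
rewrite -subr_eq0 -hornerN -hornerD -rmorphB /= (irr_root_eq0 _ P_irr P_th) => dvd_ab.
apply: val_inj; apply/eqP; rewrite -subr_eq0 /=; apply: contraLR dvd_ab => ab_neq0.
apply/negP => /(dvdp_leq ab_neq0); rewrite leqNgt => /negP[].
rewrite (leq_ltn_trans (size_polyD _ _)) // size_polyN gtn_max.
have P_gt0 : (0 < size P)%N by rewrite (ltn_trans _ P_irr.1).
by rewrite -{2 4}(prednK P_gt0) !ltnS !size_npoly.
Qed.

Lemma irr_deg_gt0 P : irreducible_poly P -> (0 < (size P).-1)%N.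
Proof. by case; case: (size P) => [|[]]. Qed.

(** With d = deg P, the values h(th) for deg h < d are already q^d distinct roots of X^(q^d) - X,
    which leaves no room for a further root y. *)
Lemma irr_fixed P y th : monic_irreducible_poly P -> root P^:K th ->
  y ^+ (q ^ (size P).-1) = y -> exists h, y = h^:K.[th].
Proof.
move=> P_mi P_th yq; pose rs := horner_npoly (size P).-1 th.
have d_gt0 : (0 < (size P).-1)%N by apply: irr_deg_gt0 P_mi.1.
have N_gt1 : (1 < q ^ (size P).-1)%N by rewrite -(exp1n (size P).-1) ltn_exp2r // finNzRing_gt1.
case: (boolP (y \in rs)) => [/mapP[h _ ->] | y_rs]; first by exists h.
have := @leq_fixed_roots _ (y :: rs) N_gt1.
rewrite /= y_rs /rs (uniq_horner_npoly P_mi.1 P_th) size_horner_npoly ltnn => /(_ isT) no_rs.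
suff : false by [].
apply: no_rs => z; rewrite inE => /orP[/eqP-> // | /mapP[h _ ->]].
exact: irr_frob.
Qed.

(** Let r = k mod d. If th^(q^r) = th, then all q^d values h(th) are fixed as well; for r > 0 they
    are roots of X^(q^r) - X, so that q^d <= q^r, against r < d. *)
Lemma irr_root_dvd P th (k : nat) : monic_irreducible_poly P -> root P^:K th ->
  (th ^+ (q ^ k) == th) = ((size P).-1 %| k)%N.
Proof.
move=> P_mi P_th; set d := (size P).-1.
have thE : th = ('X)^:K.[th] by rewrite map_polyX hornerX.
have th_d : th ^+ (q ^ d) = th by rewrite {1}thE irr_frob // -thE.
have th_dj j : th ^+ (q ^ (d * j)) = th.
  by elim: j => [|j IHj]; rewrite ?muln0 ?expr1 // mulnS expnD exprM th_d.
have -> : (th ^+ (q ^ k) == th) = (th ^+ (q ^ (k %% d)) == th).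
  by rewrite {1}(divn_eq k d) mulnC expnD exprM th_dj.
rewrite /dvdn; apply/eqP/eqP => [th_r | ->]; last by rewrite expr1.
have d_gt0 : (0 < d)%N by apply: irr_deg_gt0 P_mi.1.
apply/eqP; rewrite -leqn0 leqNgt; apply/negP => r_gt0.
have N_gt1 : (1 < q ^ (k %% d))%N by rewrite -(exp1n (k %% d)) ltn_exp2r // finNzRing_gt1.
have := @leq_fixed_roots _ (horner_npoly d th) N_gt1.
rewrite (uniq_horner_npoly P_mi.1 P_th) size_horner_npoly leq_exp2l ?finNzRing_gt1 // leqNgt ltn_mod d_gt0 => /(_ isT) no_rs.
suff : false by [].
apply: no_rs => _ /mapP[h _ ->].
by rewrite horner_frob th_r.
Qed.

Lemma irr_factor P th : monic_irreducible_poly P -> root P^:K th ->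
  P^:K = \prod_(i < (size P).-1) ('X - (th ^+ (q ^ i))%:P).
Proof.
move=> P_mi P_th; set d := (size P).-1.
have size_P : size P^:K = d.+1.
  by rewrite size_map_poly prednK // (ltn_trans _ P_mi.1.1).
have P_monic : lead_coef P^:K = 1 by rewrite lead_coef_map (monicP P_mi.2) rmorph1.
rewrite -(big_mkord xpredT (fun i => 'X - (th ^+ (q ^ i))%:P)).
rewrite -(big_map (fun i => th ^+ (q ^ i)) xpredT (fun z => 'X - z%:P)).
rewrite [LHS](all_roots_prod_XsubC (rs := [seq th ^+ (q ^ i) | i <- index_iota 0 d])).
- by rewrite P_monic scale1r.
- by rewrite size_map size_iota subn0.
- apply/allP => _ /mapP[i _ ->].
  by rewrite rootE -horner_frob (rootP P_th) expr0n expn_eq0 gtn_eqF // ltnW // finNzRing_gt1.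
rewrite uniq_rootsE map_inj_in_uniq ?iota_uniq //.
have frob_inj k : injective (fun x : K => x ^+ (q ^ k)).
  move=> x y /eqP; rewrite -subr_eq0.
  have -> : x ^+ (q ^ k) - y ^+ (q ^ k) = (x - y) ^+ (q ^ k).
    by rewrite exprDn_pchar ?card_pchar_nat // exprNn_pchar ?card_pchar_nat.
  by rewrite expf_eq0 subr_eq0 => /andP[_ /eqP].
(* Injectivity of Frobenius reduces equality of two conjugates to th^(q^(j-i)) = th, and d cannot
   divide j - i. *)
have wlog_ij i j : (i < j < d)%N -> th ^+ (q ^ i) = th ^+ (q ^ j) -> False.
  move=> /andP[lt_ij lt_jd]; rewrite -(subnK (ltnW lt_ij)) expnD exprM => /frob_inj/esym/eqP.
  rewrite (irr_root_dvd _ P_mi P_th) gtnNdvd ?subn_gt0 //.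
  by rewrite (leq_ltn_trans (leq_subr _ _)).
move=> i j; rewrite !mem_index_iota /= => lt_id lt_jd eq_ij.
case: (ltngtP i j) => // lt_ij; first by case: (wlog_ij i j); rewrite ?lt_ij.
by case: (wlog_ij j i); rewrite ?lt_ij.
Qed.

(** Euler's criterion. If the power is 1, a square root y of A(th) in [K] satisfies y^(q^d) = y, so
    y = h(th) for some h by [irr_fixed], and A is a square modulo P. *)
Lemma legendre_rootE P A th : odd q -> monic_irreducible_poly P -> root P^:K th ->
  (legendre A P)%:~R = A^:K.[th] ^+ ((q ^ (size P).-1).-1./2) :> K.
Proof.
move=> q_odd P_mi P_th; set d := (size P).-1; set N := (q ^ d)%N.
have N_odd : odd N by rewrite oddX q_odd orbT.
have N_eq : N = (N.-1./2 * 2).+1.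
  by rewrite muln2 -{1}(odd_double_half N) N_odd; congr _.+1; congr _.*2; lia.
have d_gt0 : (0 < d)%N by apply: irr_deg_gt0 P_mi.1.
have N_gt1 : (1 < N)%N by rewrite -(exp1n d) ltn_exp2r // finNzRing_gt1.
rewrite /legendre -(irr_root_eq0 _ P_mi.1 P_th).
case: eqP => [-> | /eqP A_neq0]; first by rewrite expr0n; case: eqP => //; lia.
have A_frob : (A^:K.[th] ^+ N.-1./2) ^+ 2 = 1.
  by apply: (mulIf A_neq0); rewrite -exprM -exprSr mul1r -N_eq irr_frob.
case: asboolP => [[h dvd_h] | no_h].
  have := dvd_h; rewrite -(irr_root_eq0 _ P_mi.1 P_th) rmorphB rmorphXn /= hornerD hornerN horner_exp.
  rewrite subr_eq0 => /eqP Ah; rewrite -Ah -exprM mulnC.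
  apply/esym/(mulIf (_ : h^:K.[th] != 0)).
    by apply: contraNneq A_neq0 => h0; rewrite -Ah h0 expr0n.
  by rewrite -exprSr -N_eq mul1r irr_frob.
move/eqP: A_frob; rewrite sqrf_eq1 => /orP[/eqP A1 | /eqP-> //]; exfalso; apply: no_h.
have [y yA] := closed_root A^:K.[th] (ltn0Sn 1).
have [|h yh] := irr_fixed (y := y) P_mi P_th.
  by rewrite -/d -/N N_eq mulnC exprSr exprM yA A1 mul1r.
exists h; rewrite -(irr_root_eq0 _ P_mi.1 P_th) rmorphB rmorphXn /= hornerD hornerN horner_exp.
by rewrite -yh yA subrr.
Qed.

(** The roots are the conjugates th^(q^i), so the product is A(th) to the power 1 + q + ... +
    q^(d-1), and this exponent times (q-1)/2 is (q^d-1)/2. *)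
Lemma legendre_prodE P A (rs : seq K) : odd q -> monic_irreducible_poly P ->
  P^:K = \prod_(z <- rs) ('X - z%:P) ->
  (legendre A P)%:~R = (\prod_(z <- rs) A^:K.[z]) ^+ (q.-1./2) :> K.
Proof.
move=> q_odd P_mi P_rs; set d := (size P).-1.
have size_rs : size rs = d.
  by rewrite /d -(size_map_poly iota) P_rs size_prod_XsubC.
have d_gt0 : (0 < d)%N by apply: irr_deg_gt0 P_mi.1.
have [th P_th] : exists th, root P^:K th.
  case: rs P_rs size_rs => [|th rs] P_rs size_rs; first by rewrite -size_rs in d_gt0.
  by exists th; rewrite P_rs root_prod_XsubC mem_head.
rewrite (legendre_rootE _ q_odd P_mi P_th) -/d.
have : perm_eq rs [seq th ^+ (q ^ i) | i <- index_iota 0 d].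
  by apply: prod_XsubC_eq; rewrite -P_rs (irr_factor P_mi P_th) big_map big_mkord.
move/(perm_big _)->; rewrite big_map.
under eq_bigr do rewrite -horner_frob.
rewrite -expr_sum -exprM; congr (_ ^+ _).
have q_eq : q = (q.-1./2 * 2).+1.
  by have := finNzRing_gt1 F; rewrite muln2 -{2 3}(odd_double_half q) q_odd; lia.
move: (q.-1./2) q_eq => r ->.
have -> k : ((r * 2).+1 ^ k = (\sum_(0 <= i < k) (r * 2).+1 ^ i * r) * 2 + 1)%N.
  elim: k => [|k IHk]; first by rewrite big_geq.
  by rewrite big_nat_recr //= expnS IHk; move: (\sum_(_ <= _ < _) _)%N => T; lia.
by rewrite -big_distrl /=; lia.
Qed.

End Irreducible.

(** * Unique factorization and the Jacobi symbol *)

Section Factorization.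

Variable F : finFieldType.
Implicit Types (P f h : {poly F}).

Lemma multiplicityP P f k : (1 < size P)%N -> f != 0 ->
  (P ^+ k %| f) = (k <= multiplicity P f)%N.
Proof.
move=> P_gt1 f_neq0.
have P_neq0 : P != 0 by rewrite -size_poly_eq0; case: (size P) P_gt1.
have dvd_lt j : P ^+ j %| f -> (j < size f)%N.
  move/(dvdp_leq f_neq0); apply: leq_trans.
  rewrite (polySpred (expf_neq0 j P_neq0)) size_exp ltnS leq_pmull //.
  by case: (size P) P_gt1 => [|[]].
apply/idP/idP => [dvd_k | le_k].
  by rewrite /multiplicity -[k]/(nat_of_ord (Ordinal (dvd_lt k dvd_k))); apply: leq_bigmax_cond.
have [|j dvd_j mult_j] := @eq_bigmax_cond _ [pred j : 'I_(size f) | P ^+ j %| f] (fun j => j : nat).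
  have f_gt0 : (0 < size f)%N by rewrite size_poly_gt0.
  by apply/card_gt0P; exists (Ordinal f_gt0); rewrite inE /= expr0 dvd1p.
by apply: dvdp_trans dvd_j; rewrite dvdp_exp2l // -mult_j.
Qed.

Lemma multiplicity_irrM P P0 h : monic_irreducible_poly P -> monic_irreducible_poly P0 ->
  h != 0 -> multiplicity P (P0 * h) = ((P == P0) + multiplicity P h)%N.
Proof.
move=> P_mi P0_mi h_neq0.
have P0_neq0 : P0 != 0 by apply: irredp_neq0 P0_mi.1.
have P_neq0 : P != 0 by apply: irredp_neq0 P_mi.1.
have P0h_neq0 : P0 * h != 0 by rewrite mulf_neq0.
apply/eqP; rewrite eqn_leq -!multiplicityP ?P_mi.1 ?h_neq0 //.
have [<- | neq_P] := eqVneq P P0.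
  rewrite addnC addn1 exprS dvdp_mul2l // multiplicityP ?P_mi.1 // leqnn andbT.
  case E : (multiplicity P (P * h)) => [//|m].
  by rewrite ltnS -multiplicityP ?P_mi.1 // -(dvdp_mul2l _ _ P_neq0) -exprS multiplicityP ?P_mi.1 ?mulf_neq0 // E.
rewrite add0n; apply/andP; split; last first.
  by apply: dvdp_mull; rewrite multiplicityP ?P_mi.1.
rewrite -multiplicityP ?P_mi.1 //.
have : P ^+ multiplicity P (P0 * h) %| P0 * h by rewrite multiplicityP ?P_mi.1.
rewrite Gauss_dvdpr //; apply: coprimep_expl.
rewrite (irreducible_poly_coprime _ P_mi.1); apply/negP => dvd_P.
have P_neq1 : size P != 1 by rewrite neq_ltn P_mi.1 orbT.
have := P0_mi.1.2 P P_neq1 dvd_P.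
by rewrite eqp_monic ?P_mi.2 ?P0_mi.2 // (negPf neq_P).
Qed.

Lemma irr_divisor f : (1 < size f)%N -> exists2 P, monic_irreducible_poly P & P %| f.
Proof.
have [n] := ubnP (size f); elim: n f => // n IHn f le_n f_gt1.
have f_neq0 : f != 0 by rewrite -size_poly_eq0; case: (size f) f_gt1.
have c_neq0 : (lead_coef f)^-1 != 0 by rewrite invr_eq0 lead_coef_eq0.
case: (irreducibleP f) => [f_irr | not_irr].
  exists ((lead_coef f)^-1 *: f); last by rewrite dvdpZl.
  split; last by rewrite monicE lead_coefZ mulVf // lead_coef_eq0.
  split=> [|g g_neq1]; first by rewrite size_scale.
  rewrite dvdpZr // => /(f_irr.2 _ g_neq1) /eqp_trans; apply.
  by rewrite eqp_sym eqp_scale.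
have [g [g_gt1 g_lt g_dvd]] : exists g : {poly F}, [/\ (1 < size g)%N, (size g < size f)%N & g %| f].
  apply: contra_notP not_irr => no_g; split=> // g g_neq1 g_dvd.
  rewrite -dvdp_size_eqp // eqn_leq dvdp_leq //= leqNgt; apply/negP => g_lt.
  apply: no_g; exists g; split=> //; rewrite ltn_neqAle eq_sym g_neq1 lt0n size_poly_eq0.
  by apply: contraTneq g_dvd => ->; rewrite dvd0p.
have [|P P_mi P_dvd] := IHn g _ g_gt1; first by rewrite (leq_trans g_lt).
by exists P => //; apply: dvdp_trans g_dvd.
Qed.

Lemma monic_factor f n : f \is monic -> (size f <= n)%N ->
  f = \prod_(P : {poly_n F} | (polyn P \is monic) && irreducibleb (polyn P))
        polyn P ^+ multiplicity P f.
Proof.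
have [m] := ubnP (size f); elim: m f => // m IHm f lt_fm f_monic le_fn.
have f_neq0 := monic_neq0 f_monic.
have [f_gt1 | f_le1] := ltnP 1 (size f); last first.
  have f1 : f = 1.
    by apply/eqP; rewrite -eqp_monic ?monic1 // -size_poly_eq1 eqn_leq f_le1 size_poly_gt0.
  rewrite big1 // => P /andP[_ /irreducibleP P_irr].
  suff -> : multiplicity P f = 0%N by [].
  apply/eqP; rewrite -leqn0 leqNgt -multiplicityP ?P_irr.1 // expr1 f1 dvdp1.
  by rewrite neq_ltn P_irr.1 orbT.
have [P0 P0_mi /dvdpP[h fE]] := irr_divisor f_gt1.
have h_monic : h \is monic by rewrite fE monicMr ?P0_mi.2 in f_monic.
have h_neq0 := monic_neq0 h_monic.
have P0_neq0 : P0 != 0 by apply: irredp_neq0 P0_mi.1.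
have size_f : size f = ((size P0).-1 + size h)%N.
  by rewrite fE size_mul // addnC (polySpred P0_neq0).
have P0_gt1 := irr_deg_gt0 P0_mi.1.
have size_P0 : (size P0 <= n)%N.
  by apply: leq_trans le_fn; rewrite dvdp_leq // fE dvdp_mull.
have le_h : (size h < size f)%N by rewrite size_f -[X in (X < _)%N]add0n ltn_add2r.
rewrite [LHS]fE mulrC {1}(IHm h (leq_trans le_h lt_fm) h_monic (leq_trans (ltnW le_h) le_fn)).
pose P0n : {poly_n F} := npolyp n P0.
have P0nE : polyn P0n = P0 by apply: npolypK.
have P0_cond : (polyn P0n \is monic) && irreducibleb (polyn P0n).
  by rewrite P0nE P0_mi.2; apply/irreducibleP; exact: P0_mi.1.
rewrite (bigD1 P0n) //= [RHS](bigD1 P0n) //= mulrA; congr (_ * _).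
  by rewrite P0nE fE (mulrC h) multiplicity_irrM // eqxx exprS.
apply: eq_bigr => P /andP[/andP[P_monic /irreducibleP P_irr] neq_P].
rewrite fE (mulrC h) multiplicity_irrM //.
suff /negPf-> : polyn P != P0 by [].
by rewrite -P0nE; apply: contraNneq neq_P => /val_inj->.
Qed.

End Factorization.

(** * Resultants over an algebraically closed field *)

Section RootProduct.

Variable K : closedFieldType.
Implicit Types A B p : {poly K}.

Definition closed_roots p : seq K := sval (closed_field_poly_normal p).

Lemma closed_rootsE p : p \is monic -> p = \prod_(z <- closed_roots p) ('X - z%:P).
Proof.
move/monicP => p_monic; rewrite /closed_roots; case: closed_field_poly_normal => rs /= {1}->.
by rewrite p_monic scale1r.
Qed.

Lemma size_closed_roots p : p \is monic -> size (closed_roots p) = (size p).-1.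
Proof. by move/closed_rootsE => {2}->; rewrite size_prod_XsubC. Qed.

(** For monic [p] this is the resultant of [p] and [A]. *)
Definition root_prod A p : K := \prod_(z <- closed_roots p) A.[z].

Lemma root_prodE A p rs : p = \prod_(z <- rs) ('X - z%:P) -> root_prod A p = \prod_(z <- rs) A.[z].
Proof.
move=> p_rs; apply: perm_big; apply: prod_XsubC_eq; rewrite -closed_rootsE //.
by rewrite p_rs monic_prod_XsubC.
Qed.

Lemma root_prod1 A : root_prod A 1 = 1.
Proof. by rewrite (@root_prodE A 1 [::]) ?big_nil. Qed.

Lemma root_prodMr A p1 p2 : p1 \is monic -> p2 \is monic ->
  root_prod A (p1 * p2) = root_prod A p1 * root_prod A p2.
Proof.
move=> p1_monic p2_monic.
rewrite (@root_prodE A _ (closed_roots p1 ++ closed_roots p2)) ?big_cat //=.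
by rewrite -!closed_rootsE.
Qed.

Lemma root_prodXr A p k : p \is monic -> root_prod A (p ^+ k) = root_prod A p ^+ k.
Proof.
move=> p_monic; elim: k => [|k IHk]; first exact: root_prod1.
by rewrite !exprS root_prodMr ?monic_exp // IHk.
Qed.

Lemma root_prodMl A B p : root_prod (A * B) p = root_prod A p * root_prod B p.
Proof. by rewrite -big_split; apply: eq_bigr => z _; rewrite hornerM. Qed.

Lemma root_prod_sym A p : A \is monic -> p \is monic ->
  root_prod A p = (-1) ^+ ((size A).-1 * (size p).-1) * root_prod p A.
Proof.
move=> A_monic p_monic; rewrite /root_prod.
under eq_bigr do rewrite [in X in X.[_]](closed_rootsE A_monic) horner_prod.
rewrite exchange_big /= -!size_closed_roots //.
have const_prod (c : K) (rs : seq K) : \prod_(z <- rs) c = c ^+ size rs.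
  by rewrite big_const_seq count_predT iter_mulr_1.
rewrite (mulnC (size _)) exprM -const_prod -big_split; apply: eq_bigr => w _ /=.
have -> : p.[w] = \prod_(z <- closed_roots p) (w - z).
  by rewrite {1}(closed_rootsE p_monic) horner_prod; apply: eq_bigr => z _; rewrite !hornerE.
rewrite -const_prod -big_split /=.
by apply: eq_bigr => z _; rewrite !hornerE mulN1r opprB.
Qed.

End RootProduct.

Section JacobiTheory.

Variables (F : finFieldType) (K : closedFieldType) (iota : {rmorphism F -> K}).
Hypothesis q_odd : odd #|F|.
Local Notation q := #|F|.
Local Notation r := (#|F|.-1./2).
Local Notation "p ^:K" := (map_poly iota p) (at level 2, format "p ^:K").
Implicit Types (A B P f h D : {poly F}).

Lemma odd_card_two_neq0 : 2%:R != 0 :> F.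
Proof.
apply/negP => two0; have two_char : 2 \in [pchar F] by rewrite inE.
have := abelem_pgroup (fin_ring_pchar_abelem two_char).
have := q_odd; rewrite odd_2'nat /pgroup cardsT => odd_q even_q.
have := pnat_coprime even_q odd_q; rewrite /coprime gcdnn.
by rewrite gtn_eqF // (finNzRing_gt1 F).
Qed.

Lemma two_neq0 : 2%:R != 0 :> K.
Proof. by rewrite -(rmorph_nat iota) fmorph_eq0 odd_card_two_neq0. Qed.

(** The difference lies between -2 and 2, and 1 and 2 are nonzero in [K]. This pulls identities of
    symbols back from [K] to the integers. *)
Lemma small_intr_inj (a b : int) : `|a| <= 1 -> `|b| <= 1 -> a%:~R = b%:~R :> K -> a = b.
Proof.
move=> le_a le_b /eqP; rewrite -subr_eq0 -rmorphB /= => ab.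
apply/eqP; rewrite -subr_eq0; set c := a - b in ab *.
have : `|c| <= 2 by rewrite (le_trans (ler_normB _ _)) // (lerD le_a le_b).
have two0 := two_neq0; have one0 := oner_neq0 K.
case: c ab => [[|[|[|m]]]|[|[|m]]] //; rewrite ?NegzE ?rmorphN ?oppr_eq0 /=.
- by move/eqP=> one0'; case/eqP: one0.
- by move/eqP=> two0'; case/eqP: two0.
- by move/eqP=> one0'; case/eqP: one0.
- by move/eqP=> two0'; case/eqP: two0.
Qed.

Lemma norm_legendre A P : `|legendre A P| <= 1.
Proof. by rewrite /legendre; case: ifP => // _; case: ifP. Qed.

Lemma norm_jacobi A f : `|jacobi A f| <= 1.
Proof.
rewrite /jacobi normr_prod; apply: prodr_ile1 => P _.
by rewrite normr_ge0 normrX exprn_ile1 // norm_legendre.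
Qed.

(** Root products are multiplicative in f, which extends [legendre_prodE] from irreducible
    polynomials to all monic ones. The rules for the symbol below are read off from this formula. *)
Lemma jacobiE A f : f \is monic -> (jacobi A f)%:~R = root_prod A^:K f^:K ^+ r.
Proof.
move=> f_monic; rewrite {2}(monic_factor f_monic (leqnn _)) /jacobi.
rewrite rmorph_prod /= [in RHS]rmorph_prod /=.
have [_ ->] : \prod_(P : {poly_(size f) F} | (polyn P \is monic) && irreducibleb (polyn P))
    (polyn P ^+ multiplicity (polyn P) f)^:K \is monic /\
  root_prod A^:K (\prod_(P : {poly_(size f) F} | (polyn P \is monic) && irreducibleb (polyn P))
    (polyn P ^+ multiplicity (polyn P) f)^:K) =
  \prod_(P : {poly_(size f) F} | (polyn P \is monic) && irreducibleb (polyn P))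
    root_prod A^:K (polyn P)^:K ^+ multiplicity (polyn P) f.
  apply: (big_ind2 (fun p z => p \is monic /\ root_prod A^:K p = z)).
  - by rewrite monic1 root_prod1.
  - by move=> p1 z1 p2 z2 [m1 <-] [m2 <-]; rewrite root_prodMr // monicMl.
  - move=> P /andP[P_monic _].
    by rewrite rmorphXn /= root_prodXr ?monic_exp ?map_monic.
rewrite -prodrXl; apply: eq_bigr => P /andP[P_monic /irreducibleP P_irr].
rewrite rmorphXn /= exprAC; congr (_ ^+ _).
apply: legendre_prodE => //; apply: closed_rootsE; by rewrite map_monic.
Qed.

Lemma jacobiMr A f h : f \is monic -> h \is monic ->
  jacobi A (f * h) = jacobi A f * jacobi A h.
Proof.
move=> f_monic h_monic; apply: small_intr_inj; rewrite ?norm_jacobi //.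
  by rewrite normrM mulr_ile1 ?norm_jacobi.
rewrite rmorphM /= !jacobiE ?monicMl // -exprMn; congr (_ ^+ _).
by rewrite rmorphM root_prodMr ?map_monic.
Qed.

Lemma jacobi_1r A : jacobi A 1 = 1.
Proof.
apply: small_intr_inj; rewrite ?norm_jacobi //.
by rewrite jacobiE ?monic1 // rmorph1 root_prod1 expr1n.
Qed.

Lemma jacobiXr A f k : f \is monic -> jacobi A (f ^+ k) = jacobi A f ^+ k.
Proof.
move=> f_monic; elim: k => [|k IHk]; first exact: jacobi_1r.
by rewrite !exprS jacobiMr ?monic_exp // IHk.
Qed.

Lemma jacobiMl A B f : f \is monic -> jacobi (A * B) f = jacobi A f * jacobi B f.
Proof.
move=> f_monic; apply: small_intr_inj; rewrite ?norm_jacobi //.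
  by rewrite normrM mulr_ile1 ?norm_jacobi.
by rewrite rmorphM /= !jacobiE // -exprMn rmorphM root_prodMl.
Qed.

Lemma jacobi_mod A B f : f \is monic -> f %| A - B -> jacobi A f = jacobi B f.
Proof.
move=> f_monic /dvdpP[h AB]; apply: small_intr_inj; rewrite ?norm_jacobi //.
rewrite !jacobiE //; congr (_ ^+ _); apply: eq_big_seq => z.
rewrite -root_prod_XsubC -closed_rootsE ?map_monic // => /rootP z_root.
have -> : A = h * f + B by rewrite -AB subrK.
by rewrite rmorphD rmorphM /= hornerD hornerM z_root mulr0 add0r.
Qed.

Lemma jacobi_irr A P : monic_irreducible_poly P -> jacobi A P = legendre A P.
Proof.
move=> P_mi; apply: small_intr_inj; rewrite ?norm_jacobi ?norm_legendre //.
rewrite jacobiE ?P_mi.2 //; apply/esym; apply: legendre_prodE => //.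
by apply: closed_rootsE; rewrite map_monic P_mi.2.
Qed.

(** Exchanging the arguments of a resultant costs the sign (-1)^(deg A deg f); reciprocity is the
    ((q-1)/2)-th power of this. *)
Lemma jacobi_reciprocity A f : A \is monic -> f \is monic ->
  jacobi A f = (-1) ^+ ((size A).-1 * (size f).-1 * r) * jacobi f A.
Proof.
move=> A_monic f_monic; apply: small_intr_inj; rewrite ?norm_jacobi //.
  by rewrite normrM normrX normrN1 expr1n mul1r norm_jacobi.
rewrite rmorphM /= rmorphXn rmorphN1 !jacobiE // root_prod_sym ?map_monic //.
by rewrite exprMn -exprM !size_map_poly.
Qed.

Lemma jacobi_polyC c f : f \is monic -> (jacobi c%:P f)%:~R = iota c ^+ ((size f).-1 * r) :> K.
Proof.
move=> f_monic; rewrite jacobiE // exprM; congr (_ ^+ _).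
rewrite /root_prod map_polyC /=; under eq_bigr do rewrite hornerC.
by rewrite big_const_seq count_predT iter_mulr_1 size_closed_roots ?map_monic // size_map_poly.
Qed.

End JacobiTheory.

(** * Newton's identities for the coefficients of L *)

Section MonicDegree.

Variable F : finFieldType.
Implicit Types (P f h D : {poly F}).

Definition monic_deg n : pred {poly_n.+1 F} :=
  fun f : {poly_n.+1 F} => (polyn f \is monic) && (size (polyn f) == n.+1).

Definition monic_irr n : pred {poly_n F} :=
  fun P : {poly_n F} => (polyn P \is monic) && irreducibleb (polyn P).

Lemma monic_irrP n (P : {poly_n F}) : reflect (monic_irreducible_poly (polyn P)) (monic_irr P).
Proof.
apply: (iffP andP) => [[P_monic /irreducibleP P_irr] // | [P_irr P_monic]].
by split=> //; apply/irreducibleP.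
Qed.

(** With d = deg P and m the multiplicity of P in f, this counts the powers P^j dividing f, j > 0,
    through their degrees k = d j. *)
Lemma sum_dvd_leq d m n : (0 < d)%N -> (d * m <= n)%N ->
  (\sum_(1 <= k < n.+1 | (d %| k) && (k %/ d <= m)) 1 = m)%N.
Proof.
move=> d_gt0; elim: m => [|m IHm] le_n.
  rewrite big_nat_cond big1 // => k /andP[/andP[k_gt0 _] /andP[/dvdnP[j k_eq]]].
  by rewrite k_eq mulnK // leqn0 => /eqP j0; rewrite k_eq j0 in k_gt0.
have le_n' : (d * m <= n)%N by apply: leq_trans le_n; rewrite leq_mul2l leqnSn orbT.
rewrite -[RHS]addn1 -[X in _ = (X + _)%N](IHm le_n') big_mkcond [in RHS]big_mkcond /=.
have one_k : (\sum_(1 <= k < n.+1 | k == d * m.+1) 1 = 1)%N.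
  by rewrite big_nat1_eq ltnS le_n muln_gt0 d_gt0.
rewrite -[X in _ = (_ + X)%N]one_k [X in _ = (_ + X)%N]big_mkcond -big_split; apply: eq_bigr => k _ /=.
case: (boolP (d %| k)%N) => [/dvdnP[j ->] | not_dvd] /=.
  rewrite mulnK // mulnC eqn_mul2l gtn_eqF //= addnC.
  by case: (leqP j m); case: (leqP j m.+1); case: eqP; lia.
by case: eqP => // k_eq; rewrite k_eq dvdn_mulr in not_dvd.
Qed.

Lemma sum_deg_multiplicity n f : f \is monic -> size f = n.+1 ->
  n = (\sum_(P : {poly_n.+1 F} | monic_irr P) (size (polyn P)).-1 * multiplicity (polyn P) f)%N.
Proof.
move=> f_monic size_f; have := monic_factor f_monic (leqnn _).
rewrite size_f => /(congr1 (fun p : {poly F} => (size p).-1)); rewrite size_f /= => {1}->.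
suff [] : \prod_(P : {poly_n.+1 F} | monic_irr P) polyn P ^+ multiplicity (polyn P) f \is monic /\
  (size (\prod_(P : {poly_n.+1 F} | monic_irr P) polyn P ^+ multiplicity (polyn P) f)).-1 =
  (\sum_(P : {poly_n.+1 F} | monic_irr P) (size (polyn P)).-1 * multiplicity (polyn P) f)%N by [].
apply: (big_ind2 (fun (p : {poly F}) (k : nat) => p \is monic /\ (size p).-1 = k)).
- by rewrite monic1 size_poly1.
- move=> p1 k1 p2 k2 [m1 <-] [m2 <-]; rewrite monicMl // size_monicM ?monic_neq0 //; split=> //.
  by rewrite (polySpred (monic_neq0 m1)) (polySpred (monic_neq0 m2)) /= addnS.
- by move=> P /andP[P_monic _]; rewrite monic_exp // size_exp.
Qed.

End MonicDegree.

Section Newton.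

Variables (F : finFieldType) (K : closedFieldType) (iota : {rmorphism F -> K}).
Hypothesis q_odd : odd #|F|.
Local Notation q := #|F|.
Local Notation "p ^:K" := (map_poly iota p) (at level 2, format "p ^:K").
Implicit Types (D g : {poly F}).

Lemma chi_mul_Lcoef D g n : g \is monic -> ((size g).-1 <= n)%N ->
  chi D g * Lcoef D (n - (size g).-1) =
  \sum_(f : {poly_n.+1 F} | monic_deg f && (g %| polyn f)) chi D (polyn f).
Proof.
move=> g_monic le_mn; set m := (size g).-1 in le_mn *.
have g_neq0 := monic_neq0 g_monic.
have size_g : size g = m.+1 by rewrite (polySpred g_neq0).
rewrite /Lcoef big_distrr /=.
have size_gh (h : {poly F}) : h != 0 -> size (g * h) = (m + size h)%N.
  by move=> h_neq0; rewrite size_mul // size_g.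
have mulK (h : {poly_(n - m).+1 F}) : polyn (npolyp n.+1 (g * polyn h)) = g * polyn h.
  apply: npolypK; have [->|h_neq0] := eqVneq (polyn h) 0; first by rewrite mulr0 size_poly0.
  by rewrite size_gh //; have := size_npoly h; lia.
rewrite [RHS](reindex_onto (fun h : {poly_(n - m).+1 F} => npolyp n.+1 (g * polyn h))
   (fun f => npolyp (n - m).+1 (polyn f %/ g))) /=; last first.
  move=> f /andP[/andP[f_monic /eqP size_f] /dvdpP[h fh]]; apply: val_inj => /=.
  have h_neq0 : h != 0 by apply: contraTneq f_monic => h0; rewrite fh h0 mul0r monicE lead_coef0 eq_sym oner_eq0.
  rewrite fh mulpK // !npolypK ?(mulrC g) -?fh ?size_f //.
    by move: size_f; rewrite fh mulrC size_gh //; lia.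
  by move: size_f; rewrite fh mulrC size_gh //; lia.
apply: eq_big => [h | h /andP[h_monic _]]; last by rewrite mulK /chi (jacobiMr iota q_odd) //.
rewrite /monic_deg mulK dvdp_mulr // andbT monicMl //.
have [h0 | h_neq0] := eqVneq (polyn h) 0.
  have monic0 : (0 : {poly F}) \is monic = false.
    by apply/negbTE/negP => /monic_neq0; rewrite eqxx.
  by rewrite h0 monic0.
rewrite size_gh // mulKp //.
have -> : npolyp (n - m).+1 (polyn h) == h.
  by apply/eqP/val_inj; rewrite /= npolypK // size_npoly.
rewrite andbT; congr (_ && _); move: (size _) => s; apply/eqP/eqP; lia.
Qed.

Definition fixed_roots (k : nat) : seq K := closed_roots ('X^(q ^ k) - 'X).

(** The x run over the subfield of [K] with q^k elements, on which the ((q^k-1)/2)-th power is the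
    quadratic character. *)
Definition power_sum D k : int :=
  \sum_(x <- fixed_roots k) lift_sign (D^:K.[x] ^+ (q ^ k).-1./2).

Lemma expq_gt1 k : (0 < k)%N -> (1 < q ^ k)%N.
Proof. by move=> k_gt0; rewrite -(exp1n k) ltn_exp2r // finNzRing_gt1. Qed.

Lemma XqX_monic k (R : nzRingType) : (0 < k)%N -> ('X^(q ^ k) - 'X : {poly R}) \is monic.
Proof.
move=> k_gt0; rewrite monicE lead_coefDl ?lead_coefXn //.
by rewrite size_polyN size_polyX size_polyXn ltnS expq_gt1.
Qed.

Lemma fixed_rootsE k : (0 < k)%N ->
  'X^(q ^ k) - 'X = \prod_(z <- fixed_roots k) ('X - z%:P).
Proof. by move=> k_gt0; apply: closed_rootsE; apply: XqX_monic. Qed.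

Lemma size_fixed_roots k : (0 < k)%N -> size (fixed_roots k) = (q ^ k)%N.
Proof.
by move=> k_gt0; rewrite size_closed_roots ?XqX_monic // size_XqX ?expq_gt1.
Qed.

Lemma mem_fixed_roots k x : (0 < k)%N -> (x \in fixed_roots k) = (x ^+ (q ^ k) == x).
Proof.
by move=> k_gt0; rewrite -root_prod_XsubC -fixed_rootsE // rootE !hornerE subr_eq0.
Qed.

Lemma uniq_fixed_roots k : (0 < k)%N -> uniq (fixed_roots k).
Proof.
move=> k_gt0; rewrite -separable_prod_XsubC -fixed_rootsE // separable_poly.unlock.
have q0 : (q ^ k)%N%:R = 0 :> {poly K}.
  have /pnatPpi p_char := card_pchar_nat iota k.
  have := p_char (pdiv (q ^ k)); rewrite pi_pdiv expq_gt1 // => /(_ isT) pK.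
  by apply/eqP; rewrite -polyC_natr polyC_eq0 -(dvdn_pcharf pK) pdiv_dvd.
rewrite derivB derivXn derivX -mulr_natl q0 mul0r sub0r.
by apply/Bezout_coprimepP; exists (0, -1); rewrite mul0r add0r mulrNN mulr1 eqpxx.
Qed.

Lemma lift_sign_intr (a : int) : `|a| <= 1 -> lift_sign (a%:~R : K) = a.
Proof.
have two0 := two_neq0 iota q_odd.
have sgn1 : (-1 == 1 :> K) = false.
  by apply/negbTE; rewrite eq_sym -subr_eq0 opprK.
have zero1 : (0 == 1 :> K) = false by rewrite eq_sym oner_eq0.
have zeroN1 : (0 == -1 :> K) = false by rewrite eq_sym oppr_eq0 oner_eq0.
move=> a_le1; have : a = 0 \/ a = 1 \/ a = -1 by lia.
by case=> [->|[->|->]]; rewrite /lift_sign ?rmorph0 ?rmorph1 ?rmorphN1 ?eqxx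
  ?zero1 ?zeroN1 ?sgn1 // eq_sym sgn1.
Qed.

Lemma fixed_root_irr k x : (0 < k)%N -> x \in fixed_roots k ->
  exists2 P, monic_irreducible_poly P & root P^:K x.
Proof.
move=> k_gt0; rewrite -root_prod_XsubC -fixed_rootsE // => x_root.
have := monic_factor (XqX_monic F k_gt0) (leqnn _); set N := size _.
move/(congr1 (map_poly iota)); rewrite rmorphB /= map_polyXn map_polyX => XqXE.
move: x_root; rewrite XqXE rmorph_prod rootE horner_prod prodf_seq_eq0 => /hasP[P _ /andP[/monic_irrP P_mi]].
rewrite rmorphXn horner_exp expf_eq0 => /andP[_ P_x].
by exists (polyn P).
Qed.

Lemma irr_root_uniq P P' x : monic_irreducible_poly P -> monic_irreducible_poly P' ->
  root P^:K x -> root P'^:K x -> P = P'.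
Proof.
move=> P_mi P'_mi P_x P'_x; apply/eqP; rewrite -eqp_monic ?P_mi.2 ?P'_mi.2 // /eqp.
by rewrite -(irr_root_eq0 P' P_mi.1 P_x) -(irr_root_eq0 P P'_mi.1 P'_x) -!rootE P_x P'_x.
Qed.

(** With N = q^d and j = k/d, (N^j-1)/2 = (1 + N + ... + N^(j-1)) (N-1)/2. As D(x)^N = D(x), the
    first factor amounts to a j-th power, and the second is Euler's criterion. *)
Lemma irr_char D P x k : monic_irreducible_poly P -> root P^:K x -> ((size P).-1 %| k)%N ->
  lift_sign (D^:K.[x] ^+ (q ^ k).-1./2) = chi D P ^+ (k %/ (size P).-1).
Proof.
move=> P_mi P_x /dvdnP[j ->]; have d_gt0 := irr_deg_gt0 P_mi.1.
rewrite mulnK // /chi (jacobi_irr iota) //; set d := (size P).-1.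
rewrite -[RHS]lift_sign_intr; last by rewrite normrX exprn_ile1 // norm_legendre.
rewrite rmorphXn /= (legendre_rootE _ q_odd P_mi P_x) -/d -exprM; congr lift_sign.
set z := D^:K.[x].
have zq i : z ^+ ((q ^ d) ^ i)%N = z.
  by elim: i => [|i IHi]; rewrite ?expr1 // expnS exprM irr_frob.
rewrite mulnC expnM; move: zq; set N := (q ^ d)%N => zq.
have N_odd : odd N by rewrite oddX q_odd orbT.
have [s N_eq] : exists s, N = (s * 2).+1.
  by exists N./2; rewrite muln2 -{1}(odd_double_half N) N_odd.
have -> : (N.-1./2 = s)%N by rewrite N_eq; lia.
have -> : ((N ^ j).-1./2 = (\sum_(i < j) N ^ i) * s)%N.
  by rewrite predn_exp {1}N_eq /= mulnAC muln2 doubleK mulnC.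
rewrite exprM expr_sum; under eq_bigr do rewrite zq.
by rewrite prodr_const card_ord -exprM mulnC.
Qed.

Lemma count_irr_roots P k : (0 < k)%N -> monic_irreducible_poly P -> ((size P).-1 %| k)%N ->
  count (root P^:K) (fixed_roots k) = (size P).-1.
Proof.
move=> k_gt0 P_mi dvd_k; have d_gt0 := irr_deg_gt0 P_mi.1.
have P_monic : P^:K \is monic by rewrite map_monic P_mi.2.
have size_roots : size (closed_roots P^:K) = (size P).-1.
  by rewrite size_closed_roots // size_map_poly.
have mem_roots x : (x \in closed_roots P^:K) = root P^:K x.
  by rewrite -root_prod_XsubC -closed_rootsE.
have fixedP x : root P^:K x -> x \in fixed_roots k.
  by move=> P_x; rewrite mem_fixed_roots // (irr_root_dvd _ P_mi P_x).
rewrite -size_roots -size_filter; apply/perm_size/uniq_perm.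
- by rewrite filter_uniq // uniq_fixed_roots.
- case: (closed_roots P^:K) size_roots mem_roots (closed_rootsE P_monic) => [|th rs] size_rs mem_rs P_rs.
    by rewrite -size_rs in d_gt0.
  have P_th : root P^:K th by rewrite -mem_rs mem_head.
  have : separable_poly (\prod_(z <- th :: rs) ('X - z%:P)).
    rewrite -P_rs; apply: (@dvdp_separable _ ('X^(q ^ k) - 'X)); last first.
      by rewrite fixed_rootsE // separable_prod_XsubC uniq_fixed_roots.
    rewrite -(map_polyX iota) -rmorphXn -rmorphB /= dvdp_map.
    by rewrite -(irr_root_eq0 _ P_mi.1 P_th) rmorphB /= map_polyXn map_polyX !hornerE
      subr_eq0 (irr_root_dvd _ P_mi P_th).
  by rewrite separable_prod_XsubC.
by move=> x; rewrite mem_filter mem_roots andb_idr // => /fixedP.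
Qed.

Lemma power_sumE D k n : (0 < k)%N -> (k <= n)%N ->
  power_sum D k = \sum_(P : {poly_n.+1 F} | monic_irr P && ((size (polyn P)).-1 %| k)%N)
     (size (polyn P)).-1%:Z * chi D (polyn P) ^+ (k %/ (size (polyn P)).-1).
Proof.
move=> k_gt0 le_kn.
transitivity (\sum_(x <- fixed_roots k)
  \sum_(P : {poly_n.+1 F} | monic_irr P && ((size (polyn P)).-1 %| k)%N)
    if root (polyn P)^:K x then chi D (polyn P) ^+ (k %/ (size (polyn P)).-1) else 0).
  apply: eq_big_seq => x x_fix; have [P P_mi P_x] := fixed_root_irr k_gt0 x_fix.
  have dvd_k : ((size P).-1 %| k)%N by rewrite -(irr_root_dvd _ P_mi P_x) -mem_fixed_roots.
  have P_n : polyn (npolyp n.+1 P) = P.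
    apply: npolypK; rewrite -ltnS; case: (size P) dvd_k => // d /= dvd_k.
    by rewrite !ltnS (leq_trans (dvdn_leq _ dvd_k)).
  have P_irr : monic_irr (npolyp n.+1 P) by apply/monic_irrP; rewrite P_n.
  rewrite (bigD1 (npolyp n.+1 P)) ?P_irr ?P_n //= P_x (irr_char _ P_mi P_x) // big1 ?addr0 //.
  move=> P' /andP[/andP[/monic_irrP P'_mi _] neq_P']; case: ifP => // P'_x; case/eqP: neq_P'.
  by apply: val_inj; rewrite /= P_n; apply: irr_root_uniq P'_x P_x.
rewrite exchange_big /=; apply: eq_bigr => P /andP[/monic_irrP P_mi dvd_k].
rewrite -big_mkcond big_const_seq iter_addr_0 count_irr_roots // -mulr_natl natz.
by [].
Qed.

(** Write n = deg f as the sum of deg P over the pairs (P, j), j > 0, with P^j dividing f, and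
    exchange the sums. For fixed (P, j) and k = j deg P, the multiples f of P^j contribute deg P
    chi(P)^j c_(n-k), where c_n is [Lcoef D n]; the pairs with the same k add up to S_k. This is the
    logarithmic derivative of the Euler product, coefficient by coefficient. *)
Lemma Lcoef_newton D n : n%:Z * Lcoef D n = \sum_(1 <= k < n.+1) power_sum D k * Lcoef D (n - k).
Proof.
pose t k (P f : {poly_n.+1 F}) : int :=
  if ((size (polyn P)).-1 %| k)%N && (polyn P ^+ (k %/ (size (polyn P)).-1) %| polyn f)
  then (size (polyn P)).-1%:Z * chi D (polyn f) else 0.
transitivity (\sum_(f : {poly_n.+1 F} | monic_deg f) \sum_(P : {poly_n.+1 F} | monic_irr P)
   \sum_(1 <= k < n.+1) t k P f).
  rewrite /Lcoef big_distrr; apply: eq_bigr => f /andP[f_monic /eqP size_f].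
  rewrite {1}(sum_deg_multiplicity f_monic size_f) -natz natr_sum big_distrl.
  apply: eq_bigr => P /monic_irrP P_mi /=; rewrite -big_mkcond /=.
  set d := (size _).-1; set m := multiplicity _ _.
  have d_gt0 : (0 < d)%N := irr_deg_gt0 P_mi.1.
  have le_dm : (d * m <= n)%N.
    have : polyn P ^+ m %| polyn f by rewrite multiplicityP ?P_mi.1 ?monic_neq0.
    move/(dvdp_leq (monic_neq0 f_monic)); rewrite size_f.
    by rewrite (polySpred (expf_neq0 m (irredp_neq0 P_mi.1))) size_exp ltnS.
  rewrite (eq_bigl (fun k => (d %| k)%N && (k %/ d <= m)%N)) => [|k]; last first.
    by rewrite multiplicityP ?P_mi.1 ?monic_neq0.
  rewrite -[in LHS](sum_dvd_leq d_gt0 le_dm) big_distrr natr_sum big_distrl /=.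
  by apply: eq_bigr => k _; rewrite muln1 natz.
rewrite exchange_big /=.
rewrite (eq_bigr (fun P : {poly_n.+1 F} => \sum_(1 <= k < n.+1)
   \sum_(f : {poly_n.+1 F} | monic_deg f) t k P f)); last by move=> P _; rewrite exchange_big.
rewrite exchange_big /=; apply: eq_big_nat => k /andP[k_gt0 le_kn].
rewrite (power_sumE D k_gt0 le_kn) big_distrl /= [RHS]big_mkcondr /=.
apply: eq_bigr => P /monic_irrP P_mi; rewrite /t; case: (boolP (_ %| k)%N) => [dvd_k | _] /=; last first.
  by rewrite big1.
set d := (size _).-1 in dvd_k *; set j := (k %/ d)%N.
have size_Pj : (size (polyn P ^+ j)).-1 = k by rewrite size_exp -/d mulnC divnK.
have := @chi_mul_Lcoef D (polyn P ^+ j) n; rewrite size_Pj monic_exp ?P_mi.2 // => /(_ isT le_kn) chi_c.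
rewrite -mulrA -(jacobiXr iota q_odd) ?P_mi.2 // -/(chi D _) chi_c big_distrr /= [RHS]big_mkcondr.
by [].
Qed.

End Newton.

(** * Gauss sums and the functional equation *)

(** The additive group is abelian and nontrivial, so it has more than one irreducible character and
    all are linear. Index 0 is the trivial one, so index 1 serves. *)
Lemma additive_char_exists (F : finFieldType) : exists e : F -> algC,
  [/\ e 0 = 1, forall x y, e (x + y) = e x * e y & exists x, e x != 1].
Proof.
have abF : abelian [set: F]%G by apply/centsP => x _ y _; apply: addrC.
have card_gt1 : (1 < Nirr [set: F]%G)%N.
  by rewrite NirrE; move: abF; rewrite card_classes_abelian => /eqP->; rewrite cardsT finNzRing_gt1.
have chi_lin i : 'chi[[set: F]%G]_i \is a linear_char by move/char_abelianP: abF; apply.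
pose i : Iirr [set: F]%G := Ordinal card_gt1.
exists ('chi_i); split; first exact: (lin_char1 (chi_lin i)).
  by move=> x y; apply: (lin_charM (chi_lin i)); rewrite inE.
apply: contrapT => chi1; have : 'chi_i = 'chi_0.
  rewrite irr0; apply/cfun_inP => x x_in; rewrite cfun1E x_in.
  by apply/eqP/negPn/negP => chix; apply: chi1; exists x.
by move/irr_inj => /(congr1 val).
Qed.

Section NpolySums.

Variable F : finFieldType.
Local Notation q := #|F|.
Implicit Types (D : {poly F}).

Lemma sum_npoly_bij (R : nmodType) (T : finType) (h : T -> {poly F}) N (G : {poly F} -> R) :
  injective h -> (forall t, (size (h t) <= N)%N) -> #|T| = (q ^ N)%N ->
  \sum_(a : {poly_N F}) G (polyn a) = \sum_t G (h t).
Proof.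
move=> h_inj size_h card_T; pose k t := npolyp N (h t).
have kE t : polyn (k t) = h t by apply: npolypK.
have k_inj : injective k by move=> s t /(congr1 val); rewrite /= !kE => /h_inj.
rewrite (reindex k) /=; last by apply/onW_bij/inj_card_bij; rewrite // card_npoly card_T.
by apply: eq_bigr => t _; rewrite kE.
Qed.

Lemma sum_npoly_pair (R : nmodType) (m n : nat) (h : {poly F} -> {poly F} -> {poly F}) (G : {poly F} -> R) :
  (forall (a a' : {poly_m F}) (b b' : {poly_n F}),
     h (polyn a) (polyn b) = h (polyn a') (polyn b') -> a = a' /\ b = b') ->
  (forall (a : {poly_m F}) (b : {poly_n F}), (size (h (polyn a) (polyn b)) <= m + n)%N) ->
  \sum_(a : {poly_(m + n) F}) G (polyn a) =
  \sum_(a : {poly_m F}) \sum_(b : {poly_n F}) G (h (polyn a) (polyn b)).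
Proof.
move=> h_inj size_h.
rewrite (@sum_npoly_bij _ ({poly_m F} * {poly_n F})%type (fun ab => h (polyn ab.1) (polyn ab.2))).
- by rewrite pair_bigA.
- by move=> [a b] [a' b'] /= /h_inj[-> ->].
- by move=> [a b]; apply: size_h.
- by rewrite card_prod !card_npoly expnD.
Qed.

Lemma sum_monic_deg (R : nmodType) n (G : {poly F} -> R) :
  \sum_(f : {poly_n.+1 F} | monic_deg f) G (polyn f) = \sum_(a : {poly_n F}) G ('X^n + polyn a).
Proof.
have size_Xa (a : {poly_n F}) : size ('X^n + polyn a) = n.+1.
  by rewrite size_polyDl size_polyXn // ltnS size_npoly.
have npK (a : {poly_n F}) : polyn (npolyp n.+1 ('X^n + polyn a)) = 'X^n + polyn a.
  by apply: npolypK; rewrite size_Xa.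
rewrite (reindex_onto (fun a : {poly_n F} => npolyp n.+1 ('X^n + polyn a))
  (fun f => npolyp n (polyn f - 'X^n))) /=; last first.
  move=> f /andP[/monicP f_monic /eqP size_f]; apply: val_inj => /=.
  rewrite [polyn (npolyp n _)]npolypK ?[_ + (_ - _)]addrC ?subrK; first by rewrite npolypK ?size_f.
  apply/leq_sizeP => j; rewrite leq_eqVlt => /orP[/eqP<- | lt_nj].
    by move: f_monic; rewrite lead_coefE size_f coefB coefXn eqxx => ->; rewrite subrr.
  by rewrite coefB coefXn gtn_eqF // nth_default ?subrr // size_f.
apply: eq_big => [a | a _]; last by rewrite npK.
rewrite /monic_deg npK size_Xa eqxx monicE lead_coefDl ?lead_coefXn ?eqxx ?size_polyXn ?ltnS ?size_npoly //.
by apply/eqP/val_inj; rewrite /= npolypK addrC addKr // size_npoly.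
Qed.

Lemma sum_npoly_small (R : nmodType) (M N : nat) (G : {poly F} -> R) : (M <= N)%N ->
  \sum_(a : {poly_N F} | (size (polyn a) <= M)%N) G (polyn a) = \sum_(a : {poly_M F}) G (polyn a).
Proof.
move=> le_MN.
have npK (a : {poly_M F}) : polyn (npolyp N (polyn a)) = polyn a.
  by apply: npolypK; apply: leq_trans le_MN; apply: size_npoly.
rewrite (reindex_onto (fun a : {poly_M F} => npolyp N (polyn a)) (fun a => npolyp M (polyn a))) /=.
  apply: eq_big => [a | a _]; last by rewrite npK.
  by rewrite npK size_npoly; apply/eqP/val_inj; rewrite /= npolypK // npK size_npoly.
by move=> a size_a; apply: val_inj; rewrite /= !npolypK // size_npoly.
Qed.

End NpolySums.

(** * Residues at infinity of a/D *)

Section Residue.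

Variable F : finFieldType.
Implicit Types (a b f D P E : {poly F}).

(* The coefficient of 1/x in the Laurent expansion of a/D at infinity. *)
Definition residue D a : F := (a %% D)`_(size D).-2.

Lemma residueD D a b : residue D (a + b) = residue D a + residue D b.
Proof. by rewrite /residue modpD coefD. Qed.

Lemma residue_mod D a b : D %| a - b -> residue D a = residue D b.
Proof. by move=> /modp_eq0P; rewrite modpD modpN /residue => /eqP; rewrite subr_eq0 => /eqP->. Qed.

Lemma residue_dvd D a : D %| a -> residue D a = 0.
Proof. by move=> /modp_eq0P; rewrite /residue => ->; rewrite coef0. Qed.

Lemma residue_small D a : (size a < size D)%N -> residue D a = a`_(size D).-2.
Proof. by move=> lt_aD; rewrite /residue modp_small. Qed.

Lemma coef_mul_monic a b n m : (size a <= n.+1)%N -> b \is monic -> size b = m.+1 ->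
  (a * b)`_(n + m) = a`_n.
Proof.
move=> le_a b_monic size_b; have [lt_a | ge_a] := ltnP (size a) n.+1.
  rewrite ![_`_(_)]nth_default // ?(leq_trans (size_polyMleq _ _)) // size_b; last by lia.
have size_a : size a = n.+1 by apply/eqP; rewrite eqn_leq le_a.
have a_neq0 : a != 0 by rewrite -size_poly_eq0 size_a.
have := lead_coef_Mmonic a b_monic; rewrite !lead_coefE size_Mmonic // size_a size_b.
by rewrite addnS.
Qed.

Lemma residue_mul P E a : P \is monic -> E \is monic -> (1 < size P)%N ->
  residue (P * E) (a * E) = residue P a.
Proof.
move=> P_monic E_monic P_gt1; rewrite /residue.
have E_neq0 := monic_neq0 E_monic; have P_neq0 := monic_neq0 P_monic.
have size_E : size E = (size E).-1.+1 by rewrite (polySpred E_neq0).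
have -> : (a * E) %% (P * E) = (a %% P) * E.
  have eq_aE : a * E = (a %/ P) * (P * E) + (a %% P) * E.
    by rewrite mulrA -mulrDl -divp_eq.
  apply/esym/(Pdiv.Field.modpP eq_aE); have [-> | r_neq0] := eqVneq (a %% P) 0.
    by rewrite mul0r size_poly0 size_poly_gt0 mulf_neq0.
  by rewrite !size_mul // ltn_predRL prednK ?ltn_add2r ?ltn_modp // addn_gt0 size_poly_gt0 r_neq0.
have -> : ((size (P * E)%R).-2 = (size P).-2 + (size E).-1)%N.
  rewrite size_mul //; move: P_gt1 size_E; case: (size P) => [|[|s]] // _.
  by case: (size E) => // t _; rewrite addnS addSn.
apply: coef_mul_monic => //; rewrite -ltnS.
by have := ltn_modpN0 a P_neq0; move: P_gt1; case: (size P) => [|[|s]].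
Qed.

Lemma residue_modr D f a : residue D (f * (a %% D)) = residue D (f * a).
Proof.
by apply: residue_mod; rewrite -mulrBr dvdp_mull // -dvdpNr opprB {1}(divp_eq a D) addrK dvdp_mull.
Qed.

Lemma npoly_modK D a : D != 0 -> polyn (npolyp (size D).-1 (a %% D)) = a %% D.
Proof.
move=> D_neq0; apply: npolypK; rewrite -ltnS prednK ?ltn_modp //.
by rewrite size_poly_gt0.
Qed.

Lemma npoly_eq_mod D (a b : {poly_(size D).-1 F}) : D != 0 -> D %| polyn a - polyn b -> a = b.
Proof.
move=> D_neq0 dvd_ab; apply: val_inj; apply/eqP; rewrite -subr_eq0 /=.
have : (size (polyn a - polyn b)%R < size D)%N.
  rewrite (leq_ltn_trans (size_polyD _ _)) // size_polyN gtn_max.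
  have lt_D (c : {poly_(size D).-1 F}) : (size (polyn c) < size D)%N.
    by rewrite (leq_ltn_trans (size_npoly c)) // prednK // size_poly_gt0.
  by rewrite !lt_D.
by move/modp_small => <-; apply/eqP/modp_eq0P.
Qed.

End Residue.

Section GaussSums.

Variable F : finFieldType.
Local Notation q := #|F|.
Implicit Types (D P E a b f : {poly F}).

Variable e : F -> algC.
Hypotheses (e0 : e 0 = 1) (eD : forall x y, e (x + y) = e x * e y).
Variable x0 : F.
Hypothesis ex0 : e x0 != 1.

Lemma sum_additive_char (V : finZmodType) (phi : V -> F) (v0 : V) :
  {morph phi : u v / u + v} -> e (phi v0) != 1 -> \sum_v e (phi v) = 0.
Proof.
move=> phiD ev0; have: (e (phi v0) - 1) * (\sum_v e (phi v)) = 0.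
  rewrite mulrBl mul1r [X in _ - X](reindex_inj (addrI v0)) big_distrr /=.
  by under [X in _ - X]eq_bigr do rewrite phiD eD; rewrite subrr.
by move/eqP; rewrite mulf_eq0 subr_eq0 (negPf ev0) => /eqP.
Qed.

(** The exponent is a linear form in b, so the sum is q^m or 0 according to whether the form
    vanishes. It vanishes exactly when the product of f mod D with b never reaches degree deg D -
    1. *)
Lemma sum_residue D f m : D \is monic -> (m < size D)%N ->
  \sum_(b : {poly_m F}) e (residue D (f * polyn b)) =
  if (size (f %% D)%R + m < size D)%N then (q ^ m)%N%:R else 0.
Proof.
move=> D_monic lt_mD; have D_neq0 := monic_neq0 D_monic.
have resE b : residue D (f * b) = residue D ((f %% D) * b).
  apply: residue_mod; rewrite -mulrBl dvdp_mulr //.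
  by rewrite {1}(divp_eq f D) addrK dvdp_mull.
under eq_bigr do rewrite resE.
have [r rE] : exists r : {poly F}, f %% D = r by exists (f %% D).
rewrite rE; have lt_r : (size r < size D)%N by rewrite -rE ltn_modp.
case: ifPn => [lt_rm | ge_rm].
  rewrite (eq_bigr (fun=> 1)) => [|b _]; first by rewrite sumr_const card_npoly.
  have size_rb : (size (r * polyn b)%R <= (size D).-2)%N.
    have [-> | b_neq0] := eqVneq (polyn b) 0; first by rewrite mulr0 size_poly0.
    have [-> | r_neq0] := eqVneq r 0; first by rewrite mul0r size_poly0.
    rewrite size_mul //; have := size_npoly b.
    have : (size (polyn b) > 0)%N by rewrite size_poly_gt0.
    by move: lt_rm; move: (size D) (size r) (size (polyn b)) => sD sr sb; lia.
  rewrite residue_small ?nth_default //.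
  by rewrite (leq_ltn_trans size_rb) // -ltnS; move: lt_mD; case: (size D) => [|[|s]]; rewrite //= => _; lia.
have r_neq0 : r != 0.
  by apply: contraNneq ge_rm => ->; rewrite size_poly0.
have lr_neq0 : lead_coef r != 0 by rewrite lead_coef_eq0.
have size_r : (0 < size r)%N by rewrite size_poly_gt0.
set k := ((size D).-1 - size r)%N.
(* Chosen so that r b0 has leading term x0 X^(deg D - 1), hence residue x0. *)
pose b0 := (x0 / lead_coef r) *: 'X^k.
have lt_km : (k < m)%N by rewrite /k; move: ge_rm lt_r; move: (size D) (size r) => sD sr; lia.
have b0E : polyn (npolyp m b0) = b0.
  by apply: npolypK; rewrite (leq_trans (size_scale_leq _ _)) // size_polyXn.
apply: (@sum_additive_char _ (fun b : {poly_m F} => residue D (r * polyn b)) (npolyp m b0)).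
  by move=> a b /=; rewrite mulrDr residueD.
rewrite b0E /b0 -scalerAr residue_small; last first.
  by rewrite (leq_ltn_trans (size_scale_leq _ _)) // size_Mmonic ?monicXn // size_polyXn /k; move: lt_r size_r; move: (size D) (size r) => sD sr; lia.
rewrite coefZ coefMXn; have -> : ((size D).-2 < k)%N = false.
  by rewrite /k; move: lt_r size_r; move: (size D) (size r) => sD sr; lia.
have -> : ((size D).-2 - k = (size r).-1)%N.
  by rewrite /k; move: lt_r size_r; move: (size D) (size r) => sD sr; lia.
by rewrite -lead_coefE divfK.
Qed.

Definition jacobi_gauss D f : algC :=
  \sum_(a : {poly_(size D).-1 F}) (jacobi (polyn a) D)%:~R * e (residue D (f * polyn a)).

Definition quad_gauss D f : algC :=
  \sum_(a : {poly_(size D).-1 F}) e (residue D (f * polyn a ^+ 2)).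

Variables (K : closedFieldType) (iota : {rmorphism F -> K}).
Hypothesis q_odd : odd q.

Lemma jacobi_modl D a : D \is monic -> jacobi (a %% D) D = jacobi a D.
Proof.
move=> D_monic; apply: (jacobi_mod iota q_odd D_monic).
by rewrite -dvdpNr opprB {1}(divp_eq a D) addrK dvdp_mull.
Qed.

Lemma jacobi_gaussM_coprime D f b : D \is monic -> coprimep D b ->
  jacobi_gauss D f = (jacobi b D)%:~R * jacobi_gauss D (f * b).
Proof.
move=> D_monic D_b; have D_neq0 := monic_neq0 D_monic.
rewrite /jacobi_gauss (reindex_inj (h := fun a : {poly_(size D).-1 F} => npolyp (size D).-1 ((b * polyn a) %% D))) /=.
  rewrite big_distrr; apply: eq_bigr => a _ /=; rewrite npoly_modK // residue_modr jacobi_modl //.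
  by rewrite (jacobiMl iota q_odd) // rmorphM /= mulrA mulrA.
move=> a a' /(congr1 val) /=; rewrite !npoly_modK // => eq_ba.
apply: npoly_eq_mod => //; rewrite -(Gauss_dvdpr _ D_b) mulrBr.
by apply/modp_eq0P; rewrite modpD modpN eq_ba subrr.
Qed.

Lemma sum_sqrt_mod P b : monic_irreducible_poly P ->
  \sum_(a : {poly_(size P).-1 F}) (nat_of_bool (P %| polyn a ^+ 2 - b)%R)%:Z = 1 + legendre b P.
Proof.
move=> P_mi; have P_neq0 := irredp_neq0 P_mi.1.
have P_prime (x y : {poly F}) : P %| x * y -> P %| x \/ P %| y.
  move=> dvd_xy; case: (boolP (P %| x)) => [|not_x]; first by left.
  have cop_x : coprimep P x by rewrite (irreducible_poly_coprime _ P_mi.1).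
  by right; rewrite -(Gauss_dvdpr _ cop_x).
rewrite /legendre; case: ifP => [dvd_b | not_dvd].
  rewrite (bigD1 0) //= big1 ?addr0 => [|a a_neq0].
    by rewrite expr0n sub0r dvdpNr dvd_b.
  case: (boolP (_ %| _)) => // dvd_a; case/eqP: a_neq0; apply: npoly_eq_mod => //=.
  have : P %| polyn a ^+ 2 by rewrite -(subrK b (polyn a ^+ 2)) dvdp_add.
  by rewrite subr0 expr2 => /P_prime[].
case: asboolP => [[h dvd_h] | no_h]; last first.
  by rewrite big1 // => a _; case: (boolP (_ %| _)) => // dvd_a; case: no_h; exists (polyn a).
pose hp := npolyp (size P).-1 (h %% P).
have hpE : polyn hp = h %% P by rewrite npoly_modK.
have dvd_hp : P %| polyn hp - h.
  by rewrite hpE -dvdpNr opprB {1}(divp_eq h P) addrK dvdp_mull.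
have sq_hp : P %| polyn hp ^+ 2 - b.
  have -> : polyn hp ^+ 2 - b = (polyn hp - h) * (polyn hp + h) + (h ^+ 2 - b) by rewrite -subr_sqr; ring.
  by rewrite dvdp_add // dvdp_mulr.
have hp_neqN : hp != - hp.
  apply/eqP => hpN; case/negP: not_dvd.
  have hp0 : polyn hp = 0.
    have /eqP := congr1 val hpN; rewrite /= -subr_eq0 opprK -mulr2n -scaler_nat scaler_eq0.
    by rewrite (negPf (odd_card_two_neq0 q_odd)) => /eqP.
  by move: sq_hp; rewrite hp0 expr0n sub0r dvdpNr.
rewrite (bigD1 hp) //= (bigD1 (- hp)) 1?eq_sym //= big1 ?addr0 => [|a /andP[a_hp a_Nhp]].
  by rewrite sqrrN sq_hp.
case: (boolP (_ %| _)) => // dvd_a; exfalso.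
have : P %| (polyn a - polyn hp) * (polyn a + polyn hp).
  have -> : (polyn a - polyn hp) * (polyn a + polyn hp) = (polyn a ^+ 2 - b) - (polyn hp ^+ 2 - b).
    by rewrite -subr_sqr; ring.
  by rewrite dvdp_sub.
case/P_prime => dvd_ah.
  by case/eqP: a_hp; apply: npoly_eq_mod.
by case/eqP: a_Nhp; apply: npoly_eq_mod => //=; rewrite opprK.
Qed.

(** Collect the a by the class b of their square: b has 1 + (b/P) square roots modulo P, and the
    summand 1 yields the first term. *)
Lemma quad_gauss_irr P f : monic_irreducible_poly P ->
  quad_gauss P f = (if P %| f then (q ^ (size P).-1)%N%:R else 0) + jacobi_gauss P f.
Proof.
move=> P_mi; have P_neq0 := irredp_neq0 P_mi.1; have P_gt1 : (1 < size P)%N := P_mi.1.1.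
have sum_e : \sum_(b : {poly_(size P).-1 F}) e (residue P (f * polyn b)) =
    if P %| f then (q ^ (size P).-1)%N%:R else 0.
  rewrite sum_residue ?P_mi.2 ?prednK ?size_poly_gt0 //.
  have -> : (size (f %% P)%R + (size P).-1 < size P)%N = (size (f %% P)%R <= 0)%N.
    by move: P_gt1; move: (size P) (size _) => sP sr; lia.
  by rewrite size_poly_leq0 -/(dvdp _ _).
rewrite -sum_e /jacobi_gauss -big_split /=.
transitivity (\sum_(b : {poly_(size P).-1 F}) \sum_(a : {poly_(size P).-1 F})
    (nat_of_bool (P %| polyn a ^+ 2 - polyn b)%R)%:R * e (residue P (f * polyn b))).
  rewrite exchange_big /=; apply: eq_bigr => a _.
  pose b := npolyp (size P).-1 (polyn a ^+ 2 %% P).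
  have bE : polyn b = polyn a ^+ 2 %% P by rewrite npoly_modK.
  have dvd_b : P %| polyn a ^+ 2 - polyn b.
    by rewrite bE {1}(divp_eq (polyn a ^+ 2) P) addrK dvdp_mull.
  rewrite (bigD1 b) //= dvd_b mul1r bE residue_modr big1 ?addr0 // => b' neq_b.
  case: (boolP (_ %| _)) => [dvd_b' | _]; last by rewrite mul0r.
  case/eqP: neq_b; apply: npoly_eq_mod => //.
  have -> : polyn b' - polyn b = (polyn a ^+ 2 - polyn b) - (polyn a ^+ 2 - polyn b') by ring.
  by rewrite dvdp_sub.
apply: eq_bigr => b _; rewrite -big_distrl /= -{2}[e _]mul1r -mulrDl; congr (_ * _).
rewrite (jacobi_irr iota q_odd) // -[1](rmorph1 (intr : int -> algC)) -rmorphD /= -sum_sqrt_mod //.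
by rewrite rmorph_sum.
Qed.

(** Here every term of the quadratic sum is 1, and the first term of [quad_gauss_irr] already
    accounts for the total. *)
Lemma jacobi_gauss0_irr P f : monic_irreducible_poly P -> P %| f -> jacobi_gauss P f = 0.
Proof.
move=> P_mi dvd_f; have := quad_gauss_irr f P_mi; rewrite dvd_f.
have -> : quad_gauss P f = (q ^ (size P).-1)%N%:R.
  rewrite /quad_gauss (eq_bigr (fun=> 1)) ?sumr_const ?card_npoly // => a _.
  by rewrite residue_dvd // dvdp_mulr.
by move/eqP; rewrite -subr_eq0 opprD addrA subrr sub0r oppr_eq0 => /eqP.
Qed.

(* For squarefree D the first part says that the Gauss sum of the (primitive)
   character (./D) equals quad_gauss D 1, sign included; both parts are needed for
   an induction on the prime factors of D, since the Chinese remainder theorem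
   introduces twists by the cofactors. *)
Definition gauss_proportional D :=
  (forall f, jacobi_gauss D f = (jacobi f D)%:~R * quad_gauss D 1) /\
  (forall f, coprimep D f -> quad_gauss D f = (jacobi f D)%:~R * quad_gauss D 1).

Lemma gauss_proportional_irr P : monic_irreducible_poly P -> gauss_proportional P.
Proof.
move=> P_mi; have P_gt1 : (1 < size P)%N := P_mi.1.1.
have coprimeP f : coprimep P f = ~~ (P %| f) by apply: irreducible_poly_coprime P_mi.1.
have quad1 : quad_gauss P 1 = jacobi_gauss P 1.
  by rewrite quad_gauss_irr // dvdp1 gtn_eqF // add0r.
have jac f : jacobi_gauss P f = (jacobi f P)%:~R * quad_gauss P 1.
  rewrite quad1 (jacobi_irr iota q_odd) //; case: (boolP (P %| f)) => [dvd_f | not_f].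
    by rewrite jacobi_gauss0_irr // /legendre dvd_f mul0r.
  rewrite [in RHS](@jacobi_gaussM_coprime P 1 f) ?P_mi.2 ?coprimeP // mul1r mulrA.
  rewrite (jacobi_irr iota q_odd) // -rmorphM /=.
  suff -> : legendre f P * legendre f P = 1 by rewrite mul1r.
  by rewrite /legendre (negPf not_f); case: ifP.
split=> // f; rewrite coprimeP => not_f.
by rewrite quad_gauss_irr // (negPf not_f) add0r jac.
Qed.

Lemma sum_npoly_crt (P E : {poly F}) (G : {poly F} -> algC) :
  P \is monic -> E \is monic -> coprimep P E -> (1 < size P)%N -> (1 < size E)%N ->
  \sum_(a : {poly_(size (P * E)%R).-1 F}) G (polyn a) =
  \sum_(a : {poly_(size P).-1 F}) \sum_(b : {poly_(size E).-1 F}) G (polyn a * E + polyn b * P).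
Proof.
move=> P_monic E_monic P_E P_gt1 E_gt1.
have P_neq0 := monic_neq0 P_monic; have E_neq0 := monic_neq0 E_monic.
have -> : (size (P * E)%R).-1 = ((size P).-1 + (size E).-1)%N.
  by rewrite size_mul //; move: P_gt1 E_gt1; move: (size P) (size E) => sP sE; lia.
apply: (sum_npoly_pair (h := fun a b => a * E + b * P)) => [a a' b b' eq_ab | a b].
  have eq_ab' : (polyn a - polyn a') * E = (polyn b' - polyn b) * P.
    by apply/eqP; rewrite -subr_eq0; move/eqP: eq_ab; rewrite -subr_eq0 => /eqP <-; apply/eqP; ring.
  split; apply: npoly_eq_mod => //.
    by rewrite -(Gauss_dvdpl _ P_E) eq_ab' dvdp_mull.
  rewrite -dvdpNr opprB -(Gauss_dvdpl _ (_ : coprimep E P)) ?(coprimep_sym E) //.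
  by rewrite -eq_ab' dvdp_mull.
have size_mul' n (x y : {poly F}) : (size x <= n)%N -> y != 0 -> (size (x * y)%R <= n + (size y).-1)%N.
  move=> le_x y_neq0; have [-> | x_neq0] := eqVneq x 0; first by rewrite mul0r size_poly0.
  rewrite size_mul //; have : (0 < size y)%N by rewrite size_poly_gt0.
  by move: le_x; move: (size x) (size y) => sx sy; lia.
rewrite (leq_trans (size_polyD _ _)) // geq_max size_mul' ?size_npoly //.
by rewrite addnC size_mul' ?size_npoly.
Qed.

(** Substitute a E + b P. The symbol splits with the extra factor (E/P)(P/E). In the quadratic sum,
    (a E + b P)^2/(P E) = a^2 E/P + b^2 P/E + 2 a b, whose last term has residue 0; the twists by E
    and P produce the same factor (E/P)(P/E). *)
Lemma gauss_proportionalM P E : monic_irreducible_poly P -> E \is monic -> coprimep P E ->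
  (1 < size E)%N -> gauss_proportional P -> gauss_proportional E -> gauss_proportional (P * E).
Proof.
move=> P_mi E_monic P_E E_gt1 [P_jac P_quad] [E_jac E_quad].
have P_gt1 : (1 < size P)%N := P_mi.1.1; have P_monic : P \is monic := P_mi.2.
have resPE f (a b : {poly F}) : residue (P * E) (f * (a * E + b * P)) = residue P (f * a) + residue E (f * b).
  by rewrite mulrDr residueD !mulrA residue_mul // [P * E]mulrC residue_mul.
have jacM a b : jacobi (a * E + b * P) (P * E) = (jacobi a P * jacobi b E) * (jacobi E P * jacobi P E).
  rewrite (jacobiMr iota q_odd) //.
  have -> : jacobi (a * E + b * P) P = jacobi (a * E) P.
    by apply: (jacobi_mod iota q_odd P_monic); rewrite addrC addKr dvdp_mull.
  have -> : jacobi (a * E + b * P) E = jacobi (b * P) E.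
    by apply: (jacobi_mod iota q_odd E_monic); rewrite addrK dvdp_mull.
  by rewrite !(jacobiMl iota q_odd) //; ring.
have jac f : jacobi_gauss (P * E) f = (jacobi E P * jacobi P E)%:~R * (jacobi_gauss P f * jacobi_gauss E f).
  rewrite /jacobi_gauss (sum_npoly_crt (fun a => (jacobi a (P * E))%:~R * e (residue (P * E) (f * a)))) //.
  rewrite big_distrlr big_distrr /=; apply: eq_bigr => a _; rewrite big_distrr /=; apply: eq_bigr => b _.
  by rewrite jacM resPE eD !rmorphM /=; ring.
have quad f : quad_gauss (P * E) f = quad_gauss P (f * E) * quad_gauss E (f * P).
  rewrite /quad_gauss (sum_npoly_crt (fun a => e (residue (P * E) (f * a ^+ 2)))) //.
  rewrite big_distrlr /=; apply: eq_bigr => a _; apply: eq_bigr => b _.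
  rewrite -eD; congr e.
  have -> : f * (polyn a * E + polyn b * P) ^+ 2 =
    1 * ((f * E * polyn a ^+ 2) * E + (f * P * polyn b ^+ 2) * P) + (2%:R * f * polyn a * polyn b) * (P * E) by ring.
  have res0 : residue (P * E) (2%:R * f * polyn a * polyn b * (P * E)) = 0.
    by apply: residue_dvd; apply: dvdp_mull.
  by rewrite residueD res0 addr0 resPE !mul1r.
have E_P : coprimep E P by rewrite coprimep_sym.
split=> f; last rewrite coprimepMl => /andP[P_f E_f].
  rewrite jac quad !mul1r (P_quad E) // (E_quad P) // P_jac E_jac (jacobiMr iota q_odd) // !rmorphM /=.
  by ring.
rewrite !quad !mul1r (P_quad (f * E)) ?coprimepMr ?P_f // (E_quad (f * P)) ?coprimepMr ?E_f //.
rewrite (P_quad E) // (E_quad P) // (jacobiMr iota q_odd) // !(jacobiMl iota q_odd) // !rmorphM /=.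
by ring.
Qed.

Lemma gauss_proportional_sqfree D : D \is monic -> (1 < size D)%N -> squarefree_poly D ->
  gauss_proportional D.
Proof.
have [n] := ubnP (size D); elim: n D => // n IHn D lt_Dn D_monic D_gt1 D_sqfree.
have [P P_mi /dvdpP[E D_eq]] := irr_divisor D_gt1.
have P_gt1 : (1 < size P)%N := P_mi.1.1; have P_monic : P \is monic := P_mi.2.
have E_monic : E \is monic by rewrite D_eq monicMr in D_monic.
have E_neq0 := monic_neq0 E_monic; have P_neq0 := monic_neq0 P_monic.
rewrite D_eq mulrC in lt_Dn D_sqfree *.
have [E_gt1 | E_le1] := ltnP 1 (size E); last first.
  have -> : E = 1 by apply/eqP; rewrite -eqp_monic ?monic1 // -size_poly_eq1 eqn_leq E_le1 size_poly_gt0.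
  by rewrite mulr1; apply: gauss_proportional_irr.
have P_neq1 : size P != 1 by rewrite neq_ltn P_gt1 orbT.
apply: gauss_proportionalM => //.
- rewrite (irreducible_poly_coprime _ P_mi.1); apply/negP => dvd_E.
  by have /negP := D_sqfree P P_neq1; apply; rewrite expr2 dvdp_mul2l.
- exact: gauss_proportional_irr.
- apply: IHn => //.
    rewrite -ltnS (leq_trans _ lt_Dn) // ltnS size_mul //.
    by move: P_gt1 E_gt1; move: (size P) (size E) => sP sE; lia.
  move=> Q Q_neq1; apply: contra (D_sqfree Q Q_neq1); exact: dvdp_mull.
Qed.

(** The quadratic character of [F], encoded as the symbol modulo X, so that the results on
    irreducible P apply to F[X]/(X) = F. *)
Definition quad_char c : int := legendre c%:P ('X : {poly F}).

Lemma quad_char0 : quad_char 0 = 0.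
Proof. by rewrite /quad_char /legendre polyC0 dvdp0. Qed.

Definition gauss_sum : algC := \sum_c e (c ^+ 2).

Lemma X_irr : monic_irreducible_poly ('X : {poly F}).
Proof.
split; last exact: monicX.
by rewrite -['X]subr0 -polyC0; apply: irredp_XsubC.
Qed.

Lemma sum_poly1 (G : {poly F} -> algC) : \sum_(a : {poly_(size ('X : {poly F})).-1 F}) G (polyn a) = \sum_c G c%:P.
Proof.
rewrite size_polyX; apply: sum_npoly_bij => [| c|]; [exact: polyC_inj | exact: size_polyC_leq1 | by rewrite expn1].
Qed.

Lemma residueX f : residue 'X f = f.[0].
Proof.
have -> : f.[0] = (f %% 'X)`_0.
  by rewrite -['X]subr0 modp_XsubC coefC.
by rewrite /residue size_polyX.
Qed.

Lemma sum_quad_char t : \sum_c (quad_char c)%:~R * e (t * c) = (quad_char t)%:~R * gauss_sum.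
Proof.
have [jac _] := gauss_proportional_irr X_irr.
have := jac t%:P; rewrite /jacobi_gauss /quad_gauss.
rewrite (sum_poly1 (fun a => (jacobi a 'X)%:~R * e (residue 'X (t%:P * a)))).
rewrite (sum_poly1 (fun a => e (residue 'X (1 * a ^+ 2)))).
rewrite (jacobi_irr iota q_odd _ X_irr) /quad_char => jac_t.
transitivity (\sum_c (jacobi c%:P 'X)%:~R * e (residue 'X (t%:P * c%:P))).
  by apply: eq_bigr => c _; rewrite (jacobi_irr iota q_odd _ X_irr) residueX !hornerE.
rewrite jac_t /gauss_sum; congr (_ * _); apply: eq_bigr => c _.
by rewrite residueX !hornerE.
Qed.

Lemma sum_e_scale t : \sum_c e (t * c) = if t == 0 then q%:R else 0.
Proof.
case: eqP => [-> | /eqP t_neq0].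
  by rewrite (eq_bigr (fun=> 1)) ?sumr_const // => c _; rewrite mul0r e0.
apply: (sum_additive_char (v0 := x0 / t)); first by move=> x y; rewrite mulrDr.
by rewrite mulrC divfK.
Qed.

Lemma quad_char1 : quad_char 1 = 1.
Proof.
rewrite /quad_char -(jacobi_irr iota q_odd _ X_irr); apply: (small_intr_inj iota q_odd) => //.
  exact: norm_jacobi.
by rewrite (jacobi_polyC iota q_odd) ?monicX // rmorph1 expr1n.
Qed.

Lemma gauss_sum_neq0 : gauss_sum != 0.
Proof.
(* Otherwise all Fourier coefficients of quad_char vanish. *)
apply/eqP => gs0.
have : \sum_t (\sum_c (quad_char c)%:~R * e (t * c)) * e (- t) = 0.
  by rewrite big1 // => t _; rewrite sum_quad_char gs0 mulr0 mul0r.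
have -> : \sum_t (\sum_c (quad_char c)%:~R * e (t * c)) * e (- t) =
    \sum_c (quad_char c)%:~R * \sum_t e ((c - 1) * t).
  under eq_bigr do rewrite big_distrl; rewrite exchange_big; apply: eq_bigr => c _ /=.
  rewrite big_distrr; apply: eq_bigr => t _ /=; rewrite -mulrA -eD.
  by congr (_ * e _); ring.
rewrite (bigD1 1) //= sum_e_scale subrr eqxx big1 ?addr0 => [|c c_neq1]; last first.
  by rewrite sum_e_scale subr_eq0 (negPf c_neq1) mulr0.
rewrite quad_char1 mul1r => /eqP; rewrite pnatr_eq0 gtn_eqF //; apply: ltnW; exact: finNzRing_gt1.
Qed.

(** In [K] the two sides are c^(deg D (q-1)/2) and c^((q-1)/2). They agree for c != 0 because deg D
    is odd and c^(q-1) = 1. *)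
Lemma jacobi_polyC_odd D c : D \is monic -> odd (size D).-1 -> jacobi c%:P D = quad_char c.
Proof.
move=> D_monic D_odd; rewrite /quad_char -(jacobi_irr iota q_odd _ X_irr).
apply: (small_intr_inj iota q_odd); rewrite ?norm_jacobi //.
rewrite !(jacobi_polyC iota q_odd) ?monicX // size_polyX mul1n.
have q_eq : q = (q.-1./2 * 2).+1.
  by have := finNzRing_gt1 F; rewrite muln2 -{2 3}(odd_double_half q) q_odd; lia.
have r_gt0 : (0 < q.-1./2)%N by have := finNzRing_gt1 F; rewrite q_eq; case: (q.-1./2).
have [-> | c_neq0] := eqVneq c 0.
  by rewrite rmorph0 !expr0n muln_eq0 !gtn_eqF //; case: (_.-1) D_odd.
rewrite -[in LHS](odd_double_half (size D).-1) D_odd mulnDl mul1n exprD -[X in _ = X]mulr1.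
congr (_ * _); rewrite -muln2 -mulnA [(2 * _)%N]mulnC mulnC exprM.
have -> : iota c ^+ (q.-1./2 * 2) = 1.
  apply: (mulIf (_ : iota c != 0)); first by rewrite fmorph_eq0.
  by rewrite -exprSr -q_eq mul1r -rmorphXn /= expf_card.
by rewrite expr1n.
Qed.

Lemma sum_quad_char0 : \sum_c quad_char c = 0.
Proof.
apply: (@intr_inj algC); rewrite rmorph_sum /=.
transitivity (\sum_c (quad_char c)%:~R * e (0 * c)).
  by apply: eq_bigr => c _; rewrite mul0r e0 mulr1.
by rewrite sum_quad_char quad_char0 mulr0z mul0r.
Qed.

(** The substitution a -> c a shows S = quad_char c * S for c != 0. Summing over these c, where
    [quad_char] sums to 0, gives (q-1) S = 0. *)
Lemma sum_jacobi0 D m : D \is monic -> odd (size D).-1 ->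
  \sum_(a : {poly_m F}) jacobi (polyn a) D = 0.
Proof.
move=> D_monic D_odd; set S := \sum_a _.
have scale c : c != 0 -> S = quad_char c * S.
  move=> c_neq0; rewrite {1}/S (reindex_inj (h := fun a : {poly_m F} => c *: a)) /=.
    by rewrite big_distrr; apply: eq_bigr => a _; rewrite /= -mul_polyC (jacobiMl iota q_odd) // jacobi_polyC_odd.
  by apply: scalerI.
have : \sum_(c : F | c != 0) S = 0.
  rewrite (eq_bigr (fun c => quad_char c * S)) => [|c /scale //]; rewrite -big_distrl /=.
  have := sum_quad_char0; rewrite (bigD1 0) //= quad_char0 add0r => ->.
  by rewrite mul0r.
rewrite sumr_const => /eqP; rewrite mulrn_eq0 => /orP[|/eqP//].
rewrite cardC1 -leqn0 leqNgt; have := finNzRing_gt1 F; by case: q => [|[]].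
Qed.

(* The polynomials of degree < g form an isotropic subspace for a |-> res(a^2/D),
   and its orthogonal complement is spanned by it and X^g. *)
Lemma quad_gauss_value D g : D \is monic -> size D = (2 * g + 1).+1 ->
  quad_gauss D 1 = (q ^ g)%N%:R * gauss_sum.
Proof.
move=> D_monic size_D; rewrite /quad_gauss size_D /=.
have -> : (2 * g + 1 = g + g.+1)%N by lia.
have size_bX m (b : {poly F}) : (size (b * 'X^m)%R <= size b + m)%N.
  have [-> | b_neq0] := eqVneq b 0; first by rewrite mul0r size_poly0.
  by rewrite size_Mmonic ?monicXn // size_polyXn addnS.
rewrite (sum_npoly_pair (h := fun a b => a + b * 'X^g) (fun a => e (residue D (1 * a ^+ 2)))); first last.
- move=> a b; rewrite (leq_trans (size_polyD _ _)) // geq_max.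
  rewrite (leq_trans (size_npoly a)) ?leq_addr // (leq_trans (size_bX _ _)) //.
  by rewrite addnC leq_add2l size_npoly.
- move=> a a' b b' eq_ab.
  have eq_b : b = b'.
    apply: val_inj; apply/polyP => k /=; move/polyP/(_ (k + g)%N): eq_ab.
    rewrite !coefD !coefMXn addnK ltnNge leq_addl /=.
    by rewrite !(nth_default 0 (leq_trans (size_npoly _) (leq_addl k g))) !add0r.
  by move: eq_ab; rewrite eq_b => /addIr/val_inj.
rewrite exchange_big /=.
have two_neq0 : 2%:R != 0 :> F := odd_card_two_neq0 q_odd.
transitivity (\sum_(b : {poly_g.+1 F} | (size (polyn b) <= 1)%N)
    e (residue D (polyn b ^+ 2 * 'X^(2 * g))) * (q ^ g)%N%:R).
  rewrite [RHS]big_mkcond; apply: eq_bigr => b _.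
  (* In the square of a + b X^g, the term a^2 has degree at most 2g-2, hence residue 0. The cross
     term is linear in a, and its character sums to 0 over a unless b is constant. *)
  have sq_ab (a : {poly_g F}) : e (residue D (1 * (polyn a + polyn b * 'X^g) ^+ 2)) =
      e (residue D (polyn b ^+ 2 * 'X^(2 * g))) * e (residue D ((2%:R *: polyn b * 'X^g) * polyn a)).
    have -> : 1 * (polyn a + polyn b * 'X^g) ^+ 2 =
        polyn b ^+ 2 * 'X^(2 * g) + (2%:R *: polyn b * 'X^g) * polyn a + polyn a ^+ 2.
      by rewrite mul1r mulnC exprM scaler_nat; ring.
    rewrite !residueD !eD [X in _ * _ * e X](_ : _ = 0) ?e0 ?mulr1 //.
    have size_a2 : (size (polyn a ^+ 2)%R <= (g + g).-1)%N.
      rewrite expr2 (leq_trans (size_polyMleq _ _)) //.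
      by have := size_npoly a; move: (size _) => sa; lia.
    by rewrite residue_small ?nth_default // size_D /= ?(leq_ltn_trans size_a2) ?(leq_trans size_a2) //; lia.
  under eq_bigr do rewrite sq_ab; rewrite -big_distrr /= sum_residue // ?size_D; last by lia.
  have size_2b : size (2%:R *: polyn b) = size (polyn b) by rewrite size_scale.
  rewrite modp_small; last first.
    rewrite (leq_ltn_trans (size_bX _ _)) // size_2b size_D.
    by have := size_npoly b; move: (size _) => sb; lia.
  have -> : (size (2%:R *: polyn b * 'X^g)%R + g < (2 * g + 1).+1)%N = (size (polyn b) <= 1)%N.
    have [b0 | b_neq0] := eqVneq (polyn b) 0.
      by rewrite b0 scaler0 mul0r size_poly0; lia.
    rewrite size_Mmonic ?monicXn -?size_poly_eq0 ?size_2b ?size_poly_eq0 // size_polyXn.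
    by have : (0 < size (polyn b))%N; [rewrite size_poly_gt0 | move: (size _) => sb; lia].
  by case: ifP => _; rewrite ?mulr0.
rewrite -big_distrl /= mulrC; congr (_ * _).
rewrite (sum_npoly_small (fun b => e (residue D (b ^+ 2 * 'X^(2 * g))))) //.
rewrite (sum_npoly_bij (h := fun c => c%:P) (fun b => e (residue D (b ^+ 2 * 'X^(2 * g)))) polyC_inj).
- apply: eq_bigr => c _; rewrite residue_small.
    by rewrite coefMXn size_D /= addn1 /= ltnn subnn -polyC_exp coefC.
  by rewrite -polyC_exp mul_polyC size_D (leq_ltn_trans (size_scale_leq _ _)) // size_polyXn; lia.
- exact: size_polyC_leq1.
- by rewrite expn1.
Qed.

(** The analogue of [Lcoef] for f -> (f/D), which unlike (D/f) is visibly periodic modulo D. *)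
Definition dual_coef D n : int := \sum_(f : {poly_n.+1 F} | monic_deg f) jacobi (polyn f) D.

Lemma sum_npoly_lead (G : {poly F} -> algC) m :
  \sum_(a : {poly_m.+1 F}) G (polyn a) = \sum_c \sum_(a : {poly_m F}) G (c *: 'X^m + polyn a).
Proof.
rewrite (@sum_npoly_bij _ _ (F * {poly_m F})%type (fun ca => ca.1 *: 'X^m + polyn ca.2)).
- by rewrite pair_bigA.
- move=> [c a] [c' a'] /= eq_ca.
  have eq_c : c = c'.
    move/polyP/(_ m): eq_ca; rewrite !coefD !coefZ !coefXn eqxx !mulr1.
    by rewrite !(nth_default 0 (size_npoly _)) !addr0.
  by move: eq_ca; rewrite eq_c => /addrI/val_inj->.
- move=> [c a] /=; rewrite (leq_trans (size_polyD _ _)) // geq_max.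
  by rewrite (leq_trans (size_scale_leq _ _)) ?size_polyXn // (leq_trans (size_npoly a)).
- by rewrite card_prod card_npoly expnS.
Qed.

(** For c != 0, dividing by c costs the factor [quad_char c]. For c = 0 both sides vanish, the left
    one by [sum_jacobi0]. *)
Lemma sum_jacobi_lead D m c : D \is monic -> odd (size D).-1 ->
  \sum_(a : {poly_m F}) jacobi (c *: 'X^m + polyn a) D = quad_char c * dual_coef D m.
Proof.
move=> D_monic D_odd; have [-> | c_neq0] := eqVneq c 0.
  rewrite quad_char0 mul0r -[RHS](sum_jacobi0 m D_monic D_odd).
  by apply: eq_bigr => a _; rewrite scale0r add0r.
rewrite /dual_coef (sum_monic_deg m (fun f => jacobi f D)).
rewrite (reindex_inj (h := fun a : {poly_m F} => c *: a)) /=; last exact: scalerI.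
rewrite big_distrr; apply: eq_bigr => a _ /=.
by rewrite -scalerDr -mul_polyC (jacobiMl iota q_odd) // jacobi_polyC_odd.
Qed.

(* Expanding the Gauss sums of all monic f of degree n and summing over f first
   leaves only the a of degree at most 2 g - n. *)
Lemma dual_coef_gauss D g n : D \is monic -> squarefree_poly D -> size D = (2 * g + 1).+1 ->
  (n <= 2 * g)%N ->
  (dual_coef D n)%:~R * quad_gauss D 1 = (q ^ n)%N%:R * (gauss_sum * (dual_coef D (2 * g - n))%:~R).
Proof.
move=> D_monic D_sqfree size_D le_n.
have D_odd : odd (size D).-1 by rewrite size_D /=; lia.
have D_gt1 : (1 < size D)%N by rewrite size_D; lia.
have [jac _] := gauss_proportional_sqfree D_monic D_gt1 D_sqfree.
rewrite rmorph_sum /= big_distrl /=.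
transitivity (\sum_(a : {poly_(2 * g + 1) F} | (size (polyn a) <= (2 * g - n).+1)%N)
    (jacobi (polyn a) D)%:~R * e (residue D ('X^n * polyn a)) * (q ^ n)%N%:R).
  under eq_bigr do rewrite -jac.
  rewrite (sum_monic_deg n (fun f => jacobi_gauss D f)) /jacobi_gauss size_D /= exchange_big /=.
  rewrite [RHS]big_mkcond; apply: eq_bigr => a _.
  have split_e (f : {poly_n F}) : (jacobi (polyn a) D)%:~R * e (residue D (('X^n + polyn f) * polyn a)) =
      (jacobi (polyn a) D)%:~R * e (residue D ('X^n * polyn a)) * e (residue D (polyn a * polyn f)).
    by rewrite mulrDl residueD eD mulrA [polyn f * _]mulrC.
  under eq_bigr do rewrite split_e; rewrite -big_distrr /= sum_residue // ?size_D; last by lia.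
  rewrite modp_small; last by rewrite size_D ltnS size_npoly.
  have -> : (size (polyn a) + n < (2 * g + 1).+1)%N = (size (polyn a) <= (2 * g - n).+1)%N.
    by move: (size _) => sa; lia.
  by case: ifP => _; rewrite ?mulr0.
rewrite -big_distrl /= mulrC; congr (_ * _).
rewrite (sum_npoly_small (fun a => (jacobi a D)%:~R * e (residue D ('X^n * a)))); last by lia.
rewrite (sum_npoly_lead (fun a => (jacobi a D)%:~R * e (residue D ('X^n * a)))).
(* With a = c X^(2g-n) + lower terms, X^n a has degree at most 2g = deg D - 1, so its residue is
   c. *)
transitivity (\sum_c (quad_char c * dual_coef D (2 * g - n))%:~R * e c).
  apply: eq_bigr => c _; rewrite -sum_jacobi_lead // rmorph_sum big_distrl; apply: eq_bigr => a _ /=.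
  congr (_ * e _); set f := c *: _ + _.
  have size_f : (size f <= (2 * g - n).+1)%N.
    rewrite (leq_trans (size_polyD _ _)) // geq_max.
    by rewrite (leq_trans (size_scale_leq _ _)) ?size_polyXn // (leq_trans (size_npoly a)).
  rewrite residue_small; last first.
    rewrite (leq_ltn_trans (size_polyMleq _ _)) // size_polyXn size_D.
    by move: size_f; move: (size _) => sf; lia.
  rewrite coefXnM size_D addn1 /= ltnNge le_n /= /f coefD coefZ coefXn eqxx mulr1.
  by rewrite nth_default ?addr0 ?size_npoly.
have := sum_quad_char 1; rewrite quad_char1 mul1r => <-.
by rewrite big_distrl; apply: eq_bigr => c _ /=; rewrite mul1r intrM mulrAC.
Qed.

Lemma dual_coef_functional D g n : D \is monic -> squarefree_poly D -> size D = (2 * g + 1).+1 ->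
  (n <= 2 * g)%N -> (q ^ g)%N%:Z * dual_coef D n = (q ^ n)%N%:Z * dual_coef D (2 * g - n).
Proof.
move=> D_monic D_sqfree size_D le_n; apply: (@intr_inj algC); rewrite !intrM -!pmulrn.
apply: (mulIf gauss_sum_neq0).
have := dual_coef_gauss D_monic D_sqfree size_D le_n.
rewrite (quad_gauss_value D_monic size_D) => dual_eq.
by rewrite mulrAC mulrC dual_eq mulrA mulrAC.
Qed.

End GaussSums.

(** * From the dual coefficients back to L *)

Section FunctionalEquation.

Variables (F : finFieldType) (K : closedFieldType) (iota : {rmorphism F -> K}).
Hypothesis q_odd : odd #|F|.
Local Notation q := #|F|.
Variables (D : {poly F}) (g : nat).
Hypotheses (D_monic : D \is monic) (size_D : size D = (2 * g + 1).+1).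

Lemma Lcoef_dual n : Lcoef D n = (-1) ^+ (n * q.-1./2) * dual_coef D n.
Proof.
rewrite /Lcoef /dual_coef big_distrr; apply: eq_bigr => f /andP[f_monic /eqP size_f] /=.
rewrite /chi (jacobi_reciprocity iota q_odd) // size_D size_f /=; congr (_ * _).
(* As deg D = 2g+1 is odd, the sign depends only on the parity of n (q-1)/2. *)
by rewrite -mulnA mulnDl mul1n exprD -mulnA exprM sqrrN expr1n mul1r.
Qed.

Lemma Lcoef_functional n : squarefree_poly D -> (n <= 2 * g)%N ->
  (q ^ g)%N%:Z * Lcoef D n = (q ^ n)%N%:Z * Lcoef D (2 * g - n).
Proof.
move=> D_sqfree le_n; have [e [e0 eD [x0 ex0]]] := additive_char_exists F.
rewrite !Lcoef_dual mulrCA (dual_coef_functional e0 eD ex0 iota q_odd) // mulrCA; congr (_ * (_ * _)).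
rewrite -signr_odd -[in RHS]signr_odd !oddM oddB // oddM.
by [].
Qed.

Lemma Lcoef0 : Lcoef D 0 = 1.
Proof.
rewrite Lcoef_dual mul0n mul1r /dual_coef (sum_monic_deg 0 (fun f => jacobi f D)).
rewrite (big_pred1 0) => [|a]; last first.
  by apply/esym/eqP/val_inj/eqP; rewrite -size_poly_leq0 size_npoly.
rewrite expr0 addr0.
by apply: (small_intr_inj iota q_odd); rewrite ?norm_jacobi ?normr1 // (jacobi_polyC iota q_odd) // rmorph1 expr1n.
Qed.

(** Once n >= deg D, the lower part of f can be written a + b D with deg a < deg D. For each b the
    residues a + X^n mod D run over all classes, and the symbol sums to 0 over them. *)
Lemma Lcoef_large n : (2 * g < n)%N -> Lcoef D n = 0.
Proof.
have [e [e0 eD [x0 ex0]]] := additive_char_exists F.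
move=> lt_gn; rewrite Lcoef_dual /dual_coef (sum_monic_deg n (fun f => jacobi f D)).
set d := (2 * g + 1)%N.
have D_odd : odd (size D).-1 by rewrite size_D /=; lia.
have -> : n = (d + (n - d))%N by rewrite /d; lia.
set N := (d + _)%N.
rewrite (sum_npoly_pair (h := fun a b => a + b * D) (fun f => jacobi ('X^N + f) D)).
- rewrite exchange_big /= big1 ?mulr0 // => b _.
  have size_X : (size ('X^N %% D)%R <= d)%N by rewrite -ltnS -size_D ltn_modp monic_neq0.
  rewrite -[RHS](sum_jacobi0 e0 eD ex0 iota q_odd d D_monic D_odd) [RHS](reindex_inj (addrI (npolyp d ('X^N %% D)))).
  apply: eq_bigr => a _; apply: (jacobi_mod iota q_odd D_monic); rewrite /= npolypK //.
  rewrite {1}(divp_eq 'X^N D).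
  have -> : 'X^N %/ D * D + 'X^N %% D + (polyn a + polyn b * D) - ('X^N %% D + polyn a) =
    ('X^N %/ D + polyn b) * D by ring.
  exact: dvdp_mull.
- move=> a a' b b' eq_ab; have D_neq0 := monic_neq0 D_monic.
  have eq_a : a = a'.
    apply: val_inj; rewrite /= -[LHS](@modp_small _ _ D) ?size_D ?ltnS ?size_npoly //.
    rewrite -[RHS](@modp_small _ _ D) ?size_D ?ltnS ?size_npoly //.
    by move/(congr1 (fun f : {poly F} => f %% D)): eq_ab; rewrite !modpD !modp_mull !addr0.
  by move: eq_ab; rewrite eq_a => /addrI/(mulIf D_neq0)/val_inj.
- move=> a b; rewrite (leq_trans (size_polyD _ _)) // geq_max (leq_trans (size_npoly a)) ?leq_addr //=.
  have [-> | b_neq0] := eqVneq (polyn b) 0; first by rewrite mul0r size_poly0.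
  rewrite size_Mmonic // size_D -/d addnS /=; have := size_npoly b.
  by rewrite addnC leq_add2l.
Qed.

End FunctionalEquation.

(** * Bounds on the zeros of L *)

Section NewtonIdentities.

Variable C : comNzRingType.
Implicit Types (c S : nat -> C).

(* Equivalently, sum_n c_n u^n = exp (sum_(k > 0) S_k u^k / k) when c_0 = 1. *)
Definition newton c S := forall n, n%:R * c n = \sum_(j < n) S (n - j)%N * c j.

(** The logarithmic derivative of a product, one factor at a time: a new factor 1 - a X adds - a^k
    to S_k. *)
Lemma newton_prod (s : seq C) :
  newton (fun n => (\prod_(a <- s) (1 - a *: 'X))`_n) (fun k => - \sum_(a <- s) a ^+ k).
Proof.
elim: s => [|a s IHs] n.
  rewrite !big_nil big1 => [|j _]; last by rewrite !big_nil oppr0 mul0r.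
  by rewrite coef1; case: n => [|n]; rewrite ?mul0r ?mulr0.
set M := \prod_(b <- s) (1 - b *: 'X).
have coefE j : (\prod_(b <- a :: s) (1 - b *: 'X))`_j = M`_j - (if j is i.+1 then a * M`_i else 0).
  rewrite big_cons mulrBl mul1r coefB -scalerAl coefZ coefXM.
  by case: j => [|j] //=; rewrite mulr0.
have IH k : k%:R * M`_k = \sum_(j < k) (- \sum_(b <- s) b ^+ (k - j)) * M`_j := IHs k.
transitivity (\sum_(j < n) (- a ^+ (n - j) * (M`_j - (if (j : nat) is i.+1 then a * M`_i else 0)) +
  (- \sum_(b <- s) b ^+ (n - j)) * (M`_j - (if (j : nat) is i.+1 then a * M`_i else 0)))); last first.
  by apply: eq_bigr => j _; rewrite coefE big_cons opprD mulrDl.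
rewrite coefE; case: n => [|n]; first by rewrite mul0r big_ord0.
rewrite big_split /=.
(* Convolution with the powers of a inverts the factor 1 - a X, so a single coefficient of [M]
   survives. *)
have -> : \sum_(j < n.+1) - a ^+ (n.+1 - j) * (M`_j - (if (j : nat) is i.+1 then a * M`_i else 0)) = - (a * M`_n).
  elim: n => [|n IHn]; first by rewrite big_ord1 /= subr0 expr1 mulNr.
  rewrite big_ord_recr /= subSnn expr1.
  rewrite (eq_bigr (fun j : 'I_n.+1 => a * (- a ^+ (n.+1 - j) *
     (M`_j - (if (j : nat) is i.+1 then a * M`_i else 0))))) => [|j _].
    by rewrite -big_distrr /= IHn; ring.
  by rewrite subSn 1?ltnW // exprS !mulNr mulrN mulrA.
have -> : \sum_(j < n.+1) (- \sum_(b <- s) b ^+ (n.+1 - j)) *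
    (M`_j - (if (j : nat) is i.+1 then a * M`_i else 0)) = n.+1%:R * M`_n.+1 - a * (n%:R * M`_n).
  under eq_bigr do rewrite mulrBr; rewrite sumrB -IH; congr (_ - _).
  rewrite big_ord_recl /= mulr0 add0r IH big_distrr /=; apply: eq_bigr => j _.
  by rewrite subSS mulrCA.
by rewrite -natr1; ring.
Qed.

(** As c_0 = 1, the identity of index k expresses S_k through earlier terms without division. This
    identifies the character sums with the power sums of the inverse zeros. *)
Lemma newton_uniq c S S' : c 0%N = 1 -> newton c S -> newton c S' ->
  forall k, (0 < k)%N -> S k = S' k.
Proof.
move=> c0 cS cS' k; have [n] := ubnP k; elim: n k => // n IHn [//|k] lt_kn _.
have := cS k.+1; rewrite cS' !big_ord_recl /= subn0 c0 !mulr1 => eq_sum.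
apply/esym/(addIr (\sum_(i < k) S (k.+1 - (lift ord0 i))%N * c (lift ord0 i))).
rewrite -eq_sum; congr (_ + _); apply: eq_bigr => i _; congr (_ * _); apply: IHn.
  by rewrite /= subSS (leq_ltn_trans (leq_subr _ _)).
by rewrite /= subSS subn_gt0.
Qed.

End NewtonIdentities.

Section Growth.

Variable C : numClosedFieldType.
Hypothesis archiC : forall x : C, 0 <= x -> exists n, x < n%:R.

(** By Bernoulli's inequality the powers of x > 1 grow at least linearly, and [archiC] lets them
    pass [M]. *)
Lemma geometric_bounded (x M : C) m0 : 0 <= x -> (forall m, (m0 <= m)%N -> x ^+ m <= M) -> x <= 1.
Proof.
move=> x_ge0 x_le; have x_real : x \is Num.real by apply: ger0_real.
rewrite real_leNgt ?real1 //; apply/negP => x_gt1.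
have y_gt0 : 0 < x - 1 by rewrite subr_gt0.
have bern m : 1 + m%:R * (x - 1) <= x ^+ m.
  elim: m => [|m IHm]; first by rewrite mul0r addr0.
  rewrite exprS (le_trans _ (ler_wpM2l x_ge0 IHm)) //.
  have -> : x * (1 + m%:R * (x - 1)) = 1 + m.+1%:R * (x - 1) + m%:R * (x - 1) ^+ 2 by rewrite -natr1; ring.
  by rewrite lerDl mulr_ge0 // exprn_ge0 // ltW.
have M_ge0 : 0 <= M by apply: le_trans (x_le m0 (leqnn _)); rewrite exprn_ge0.
have [n lt_n] := archiC (divr_ge0 M_ge0 (ltW y_gt0)).
have := x_le (m0 + n)%N (leq_addr _ _).
apply/negP; rewrite -real_ltNge ?ger0_real ?exprn_ge0 //.
apply: lt_le_trans (bern _); rewrite -(@ltr_pM2r _ (x - 1)^-1) ?invr_gt0 //.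
rewrite (lt_trans lt_n) // mulrDl mulfK ?gt_eqF // natrD.
by rewrite addrA ltrDr ltr_wpDr // div1r invr_gt0.
Qed.

(* A polynomial vanishing at the other elements of s extracts the m-th power of a
   given b from finitely many consecutive power sums. *)
Lemma power_sums_bound (s : seq C) (Q M : C) m0 : 0 < Q ->
  (forall m, (m0 <= m)%N -> `|\sum_(b <- s) b ^+ m| <= M * Q ^+ m) ->
  {in s, forall b, `|b| <= Q}.
Proof.
move=> Q_gt0 sum_le b0 b0_s; have Q_neq0 : Q != 0 by rewrite gt_eqF.
pose l := \prod_(b <- undup s | b != b0) ('X - b%:P).
have l_b0 : l.[b0] != 0.
  rewrite horner_prod prodf_seq_neq0; apply/allP => b _; apply/implyP => neq_b.
  by rewrite !hornerE subr_eq0 eq_sym.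
have l_b b : b \in s -> b != b0 -> l.[b] = 0.
  move=> b_s neq_b; rewrite horner_prod (big_rem b) ?mem_undup //= neq_b !hornerE subrr.
  by rewrite mul0r.
have sum_l m : \sum_(t < size l) l`_t * \sum_(b <- s) b ^+ (m + t) = (count_mem b0 s)%:R * (b0 ^+ m * l.[b0]).
  under eq_bigr do rewrite big_distrr /=; rewrite exchange_big /=.
  transitivity (\sum_(b <- s) if b == b0 then b0 ^+ m * l.[b0] else 0).
    apply: eq_big_seq => b b_s.
    have -> : \sum_(t < size l) l`_t * b ^+ (m + t) = b ^+ m * l.[b].
      by rewrite horner_coef big_distrr; apply: eq_bigr => t _ /=; rewrite exprD mulrCA.
    by case: eqP => [-> // | /eqP neq_b]; rewrite l_b ?mulr0.
  by rewrite -big_mkcond big_const_seq iter_addr_0 mulr_natl.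
(* [A] and the [B] below do not depend on m, so (|b0|/Q)^m stays bounded by A/B. *)
set A := \sum_(t < size l) `|l`_t| * (M * Q ^+ t).
have cnt_gt0 : (0 < count_mem b0 s)%N by rewrite -has_count has_pred1.
set B := (count_mem b0 s)%:R * `|l.[b0]|.
have B_gt0 : 0 < B by rewrite mulr_gt0 ?ltr0n // normr_gt0.
have bound m : (m0 <= m)%N -> (`|b0| / Q) ^+ m <= A / B.
  move=> le_m; rewrite ler_pdivlMr // expr_div_n mulrAC ler_pdivrMr ?exprn_gt0 //.
  have -> : `|b0| ^+ m * B = `|(count_mem b0 s)%:R * (b0 ^+ m * l.[b0])|.
    by rewrite !normrM normr_nat normrX /B mulrCA.
  rewrite -sum_l (le_trans (ler_norm_sum _ _ _)) // big_distrl ler_sum // => t _ /=.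
  rewrite normrM -mulrA -mulrA -exprD ler_wpM2l // addnC; apply: sum_le.
  by rewrite (leq_trans le_m) // leq_addl.
have := geometric_bounded _ bound; rewrite divr_ge0 ?(ltW Q_gt0) // => /(_ isT).
by rewrite ler_pdivrMr // mul1r.
Qed.

End Growth.

(** Stepanov's bound for s = q^m and t = (q^m-1)/2; the condition g < t reads 2g+1 < q^m. *)
Lemma power_sum_bound (F : finFieldType) (K : closedFieldType) (iota : {rmorphism F -> K})
    (D : {poly F}) (g m : nat) : odd #|F| -> size D = (2 * g + 1).+1 -> (g.*2.+1 < #|F| ^ m)%N ->
  `|power_sum iota D (m.*2)| <= (g.*2.*2.+1 * #|F| ^ m)%N%:Z.
Proof.
move=> q_odd size_D lt_gq; set s := (#|F| ^ m)%N.
have s_eq : s = ((#|F| ^ m).-1./2).*2.+1.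
  have s_odd : odd s by rewrite oddX q_odd orbT.
  by rewrite -/s; move: s_odd lt_gq; rewrite -/s => s_odd _; rewrite -{1}(odd_double_half s) s_odd; lia.
have s2 : (#|F| ^ m.*2 = s ^ 2)%N by rewrite -expnM muln2.
have m_gt0 : (0 < m.*2)%N by case: (m) lt_gq.
have := @stepanov_bound K g ((#|F| ^ m).-1./2) (map_poly iota D) (fixed_roots F K m.*2).
cbv zeta; rewrite -s_eq -s2; apply.
- exact: card_pchar_nat.
- exact: two_neq0 iota q_odd.
- by move: lt_gq; rewrite -/s s_eq; lia.
- by rewrite size_map_poly size_D addn1 mul2n.
- exact: uniq_fixed_roots.
- exact: size_fixed_roots.
- by move=> x; rewrite mem_fixed_roots // => /eqP.
- by move=> x; rewrite mem_fixed_roots // => /eqP xq; rewrite horner_frob xq.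
Qed.

Section LPolynomial.

Variables (F : finFieldType) (C : numClosedFieldType).
Hypothesis archiC : forall x : C, 0 <= x -> exists n, x < n%:R.
Hypothesis q_odd : odd #|F|.
Local Notation q := #|F|.
Variables (D : {poly F}) (g : nat).
Hypotheses (D_monic : D \is monic) (size_D : size D = (2 * g + 1).+1).
Hypothesis D_sqfree : squarefree_poly D.

Definition Lpoly : {poly C} := \poly_(n < (2 * g).+1) (Lcoef D n)%:~R.

Lemma closure_exists : exists K : closedFieldType, inhabited {rmorphism F -> K}.
Proof.
have [K [iota _]] := countable_algebraic_closure F.
by exists K; constructor; exact: iota.
Qed.

Lemma coef_Lpoly n : Lpoly`_n = (Lcoef D n)%:~R.
Proof.
rewrite coef_poly; case: ltnP => // le_n.
by have [K [iota]] := closure_exists; rewrite (Lcoef_large iota q_odd D_monic size_D).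
Qed.

Let q_gt0 : 0 < q%:R :> C.
Proof. by rewrite ltr0n ltnW // finNzRing_gt1. Qed.

Lemma horner_LpolyE u : Lpoly.[u] = \sum_(n < (2 * g).+1) (Lcoef D n)%:~R * u ^+ n.
Proof. by rewrite horner_poly. Qed.

Lemma Lpoly_functional u : u != 0 -> Lpoly.[u] = (q%:R * u ^+ 2) ^+ g * Lpoly.[(q%:R * u)^-1].
Proof.
move=> u_neq0; have [K [iota]] := closure_exists.
have q_neq0 : q%:R != 0 :> C by rewrite gt_eqF.
rewrite !horner_LpolyE [RHS]big_distrr /= (reindex_inj rev_ord_inj) /=.
apply: eq_bigr => n _; have le_n : (n <= 2 * g)%N by rewrite -ltnS.
rewrite subSS; apply: (mulfI (expf_neq0 n q_neq0)).
have := Lcoef_functional iota q_odd D_monic size_D D_sqfree le_n.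
move/(congr1 (fun z : int => z%:~R : C)); rewrite /= !intrM -!pmulrn !natrX => fe.
rewrite mulrA -fe exprMn -exprM exprVn !exprMn invfM.
have -> : u ^+ (2 * g) = u ^+ (2 * g - n) * u ^+ n by rewrite -exprD subnK.
have un_neq0 : u ^+ n != 0 by rewrite expf_neq0.
have qn_neq0 : q%:R ^+ n != 0 :> C by rewrite expf_neq0.
by field; rewrite un_neq0 qn_neq0.
Qed.

(** The inverse zeros a have power sums -S_k. The bound on S_(2m) is a bound on the m-th power sums
    of the a^2, so |a^2| <= q. *)
Lemma Lpoly_root_ge u : Lpoly.[u] = 0 -> q%:R^-1 <= `|u| ^+ 2.
Proof.
move=> u_root; have [K [iota]] := closure_exists.
have L0 : Lpoly`_0 = 1 by rewrite coef_Lpoly (Lcoef0 iota q_odd D_monic size_D).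
have L_neq0 : Lpoly != 0 by apply/eqP => L_0; move/eqP: L0; rewrite L_0 coef0 eq_sym oner_eq0.
have [rs Lrs] := closed_field_poly_normal Lpoly.
have rs_neq0 z : z \in rs -> z != 0.
  move=> z_rs; apply/eqP => z0; move/eqP: L0; rewrite -horner_coef0 Lrs hornerZ.
  have /rootP-> : root (\prod_(z <- rs) ('X - z%:P)) 0 by rewrite root_prod_XsubC -z0.
  by rewrite mulr0 eq_sym oner_eq0.
pose s := [seq z^-1 | z <- rs].
have Ls : Lpoly = \prod_(a <- s) (1 - a *: 'X).
  have Lc : Lpoly = (lead_coef Lpoly * \prod_(z <- rs) (- z)) *: \prod_(a <- s) (1 - a *: 'X).
    rewrite {1}Lrs -scalerA; congr (_ *: _).
    rewrite big_map -scaler_prod; apply: eq_big_seq => z /rs_neq0 z_neq0.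
    by rewrite scalerBr scalerA mulNr divff // scaleN1r opprK addrC -alg_polyC scaleNr.
  have : (lead_coef Lpoly * \prod_(z <- rs) (- z)) = 1.
    have := congr1 (fun p : {poly C} => p`_0) Lc; rewrite /= L0 coefZ -horner_coef0 horner_prod.
    rewrite [X in _ = _ * X]big1_seq ?mulr1 // => a _.
    by rewrite !hornerE ?mulr0 ?subr0.
  by move=> c1; rewrite Lc c1 scale1r.
have Lnewton : newton (fun n => Lpoly`_n) (fun k => (power_sum iota D k)%:~R).
  move=> n; rewrite coef_Lpoly -[n%:R]/((n%:Z)%:~R) -intrM (Lcoef_newton iota q_odd).
  rewrite rmorph_sum /= big_rev_mkord subn1 /=; apply: eq_bigr => j _.
  by rewrite subSS coef_Lpoly intrM subKn // ltnW.
have psum k : (0 < k)%N -> (power_sum iota D k)%:~R = - \sum_(a <- s) a ^+ k :> C.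
  have s_newton : newton (fun n => Lpoly`_n) (fun k => - \sum_(a <- s) a ^+ k).
    by rewrite Ls; apply: newton_prod.
  by move/(newton_uniq L0 Lnewton s_newton).
have s_le a : a \in s -> `|a ^+ 2| <= q%:R.
  move=> a_s; apply: (@power_sums_bound C archiC [seq a ^+ 2 | a <- s] q%:R (g.*2.*2.+1)%:R g.*2.+2) => //.
    move=> m le_m; rewrite big_map.
    have -> : \sum_(a <- s) (a ^+ 2) ^+ m = - (power_sum iota D m.*2)%:~R.
      rewrite psum ?double_gt0 ?(leq_trans _ le_m) // opprK.
      by apply: eq_bigr => b _; rewrite -exprM mul2n.
    rewrite normrN -intr_norm -natrX -natrM -[X in _ <= X]/((_ : nat)%:Z%:~R) ler_int.
    apply: power_sum_bound => //; apply: (leq_trans le_m).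
    by apply: ltnW; apply: ltn_expl; apply: finNzRing_gt1.
  exact: map_f.
have u_rs : u \in rs.
  rewrite -root_prod_XsubC rootE; move/eqP: u_root; rewrite Lrs hornerZ mulf_eq0.
  by rewrite lead_coef_eq0 (negPf L_neq0).
have := s_le u^-1 (map_f _ u_rs).
by rewrite normrX normfV exprVn -[X in _ <= X]invrK lef_pV2 // posrE ?invr_gt0 ?exprn_gt0 ?normr_gt0 ?rs_neq0.
Qed.

(** By the functional equation 1/(q u) is a zero too, and the lower bound for its absolute value is
    the upper bound for |u|. *)
Lemma Lpoly_root_norm u : Lpoly.[u] = 0 -> `|u| ^+ 2 = q%:R^-1.
Proof.
move=> u_root; have u_ge := Lpoly_root_ge u_root.
have qV_gt0 : 0 < q%:R^-1 :> C by rewrite invr_gt0.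
have u_neq0 : u != 0.
  by apply: contraTneq u_ge => ->; rewrite normr0 expr0n /= lt_geF.
apply/eqP; rewrite eq_le u_ge andbT.
have : Lpoly.[(q%:R * u)^-1] = 0.
  move/eqP: u_root; rewrite (Lpoly_functional u_neq0) mulf_eq0 expf_eq0 mulf_eq0 expf_eq0 (negPf u_neq0).
  by rewrite (gt_eqF q_gt0) !andbF /= => /eqP.
move/Lpoly_root_ge; rewrite normfV normrM normr_nat exprVn exprMn lef_pV2 ?posrE //.
  by rewrite expr2 -mulrA -ler_pdivlMl // mulVf ?gt_eqF // -ler_pdivlMl // mulr1.
by rewrite mulr_gt0 ?exprn_gt0 ?normr_gt0.
Qed.

End LPolynomial.

Local Open Scope complex_scope.

(** * Passage to R[i] and comparison of F with L *)

Section Complex.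

Variables (R : realType) (F : finFieldType).
Hypothesis q_odd : odd #|F|.
Local Notation q := #|F|.
Variables (D : {poly F}) (g : nat).
Hypotheses (D_monic : D \is monic) (size_D : size D = (2 * g + 1).+1).

Lemma complex_archimedean (x : R[i]) : 0 <= x -> exists n, x < n%:R.
Proof.
move=> x_ge0; rewrite -(RRe_real (ger0_real x_ge0)).
exists (Num.bound (complex.Re x)); rewrite -(rmorph_nat (real_complex R)) ltcR.
by apply: archi_boundP; rewrite -lecR (RRe_real (ger0_real x_ge0)).
Qed.

(** By [Lcoef_large] the partial sums are constant from 2g+1 terms on, so the limit is the value of
    a polynomial. *)
Lemma LfunE (u : R[i]) : Lfun D u = (Lpoly R[i] D g).[u].
Proof.
rewrite /Lfun; apply: (@norm_lim_near_cst _ (R[i])^o); exists (2 * g).+1 => // n /= le_n.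
rewrite /series /= horner_LpolyE.
rewrite -(big_mkord xpredT (fun k => (Lcoef D k)%:~R * u ^+ k)).
rewrite (big_cat_nat (n := (2 * g).+1)) //= [X in _ + X]big_nat_cond [X in _ + X]big1 ?addr0 //.
move=> k /andP[/andP[lt_k _] _]; have [K [iota]] := closure_exists F.
by rewrite (Lcoef_large iota q_odd D_monic size_D) // mul0r.
Qed.

Lemma Lpoly_conj (u : R[i]) : (Lpoly R[i] D g).[conjc u] = conjc (Lpoly R[i] D g).[u].
Proof.
rewrite !horner_LpolyE rmorph_sum; apply: eq_bigr => n _.
by rewrite rmorphM rmorphXn /= rmorph_int.
Qed.

Hypotheses (g_gt0 : (0 < g)%N) (D_sqfree : squarefree_poly D).

Lemma FfunE (u : R[i]) :
  Ffun g D u = 2^-1 * ((Lpoly R[i] D g).[u] + (q%:R * u ^+ 2) ^+ g * conjc (Lpoly R[i] D g).[u]).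
Proof. by rewrite -Lpoly_conj -!LfunE. Qed.

Let q_gt0 : 0 < q%:R :> R[i].
Proof. by rewrite ltr0n ltnW // finNzRing_gt1. Qed.

Lemma Ffun_on_circle (u : R[i]) : `|u| ^+ 2 = q%:R^-1 -> Ffun g D u = (Lpoly R[i] D g).[u].
Proof.
move=> u_circle; have u_neq0 : u != 0.
  apply: contra_eqN u_circle => /eqP->; rewrite normr0 expr0n eq_sym invr_eq0.
  by rewrite gt_eqF.
rewrite FfunE -Lpoly_conj.
have -> : conjc u = (q%:R * u)^-1.
  apply: (mulfI u_neq0); rewrite -sqr_normc u_circle invfM mulrCA divff // mulr1.
  by [].
rewrite -(Lpoly_functional q_odd D_monic size_D D_sqfree u_neq0) -mulr2n -[X in _ * X = _]mulr_natl mulrA mulVf ?mul1r //.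
by rewrite pnatr_eq0.
Qed.

Lemma Ffun_eq0 (u : R[i]) : Ffun g D u = 0 <-> (Lpoly R[i] D g).[u] = 0.
Proof.
split=> [Fu0 | Lu0]; last by rewrite FfunE Lu0 rmorph0 mulr0 addr0 mulr0.
apply/eqP/negPn/negP => Lu_neq0.
suff u_circle : `|u| ^+ 2 = q%:R^-1 by move: Lu_neq0; rewrite -Ffun_on_circle // Fu0 eqxx.
move/eqP: Fu0; rewrite FfunE mulf_eq0 invr_eq0 pnatr_eq0 /= addr_eq0 => /eqP/(congr1 Num.norm).
rewrite normrN normrM normcJ -{1}[`|_|]mul1r => norm_eq.
have /esym/eqP : 1 = `|(q%:R * u ^+ 2) ^+ g| by apply: mulIf norm_eq; rewrite normr_eq0.
(* Since g > 0, |q u^2|^g = 1 forces |q u^2| = 1. *)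
rewrite normrX pexpr_eq1 // normrM normr_nat normrX => /eqP qu_eq1.
have q_neq0 : q%:R != 0 :> R[i] by rewrite gt_eqF.
by apply: (mulfI q_neq0); rewrite qu_eq1 divff.
Qed.

Lemma Lpoly_root_norm_sqrt (u : R[i]) : (Lpoly R[i] D g).[u] = 0 -> `|u| = (sqrtC q%:R)^-1.
Proof.
move=> /(Lpoly_root_norm complex_archimedean q_odd D_monic size_D D_sqfree) u2.
have -> : q%:R = `|u|^-1 ^+ 2 :> R[i] by rewrite exprVn u2 invrK.
by rewrite sqrCK ?invrK // invr_ge0.
Qed.

End Complex.

Unset Implicit Arguments.

Theorem theorem11 (R : realType) (F : finFieldType) (q_odd : odd #|F|)
    (g : nat) (g_ge1 : (1 <= g)%N)
    (D : {poly F}) (D_monic : D \is monic) (D_sqfree : squarefree_poly D)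
    (D_deg : size D = (2 * g + 1).+1) :
  (forall u : R[i], Ffun g D u = 0 <-> Lfun D u = 0) /\
  (forall u : R[i], Ffun g D u = 0 -> `|u| = (sqrtC #|F|%:R)^-1).
Proof.
have Fu_eq0 (u : R[i]) := Ffun_eq0 q_odd D_monic D_deg g_ge1 D_sqfree u.
split=> u; first by rewrite (LfunE q_odd D_monic D_deg).
by move/Fu_eq0/(Lpoly_root_norm_sqrt q_odd D_monic D_deg D_sqfree).
Qed.
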